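(* Consider the collective random walk of $n$ particles with local velocities of both signs described in the context, and suppose that one of the following two conditions holds: $$P(v_i^t>v_j^t)>0\qquad\forall i\ne j,\ \forall t,$$ or $$P(v_i^t<v_j^t)>0\qquad\forall i\ne j,\ \forall t.$$ Then the process of gaps $\Delta^t=\{\Delta_i^t\}_{i=1}^n$ with sequential updating (either the random or the deterministic one) is uniquely ergodic. The same claim holds true in the case of parallel updating if additionally for at least one index $i$ we have $$P(v_i^tv_{i+1}^t<0)>0 .$$
   Context: Particles and configurations. There are $n$ particles on the unit circle $\mathbb{R}/\mathbb{Z}\cong[0,1)$; particle indices are taken modulo $n$ and arithmetic with positions is modulo $1$. Particle $i$ has a fixed radius $r_i\ge 0$ and at time $t\in\mathbb{Z}_{\ge0}$ a center $x_i^t$; the particles are in clockwise cyclic order, and the gaps are $\Delta_i^t:=(x_{i+1}^t-r_{i+1})-(x_i^t+r_i)$, measured clockwise. A configuration (resp. a collection of gaps) is admissible if $\Delta_i^t\ge 0$ for all $i$ and $\sum_{i=1}^n(\Delta_i^t+2r_i)=1$. Velocities and updating. The random variables $\{v_i^t\}_{i,t}$ (local velocities) are mutually independent, and $v_i^t$ has distribution $P_i$ (independent of $t$) on $[-1,1]$. Multiplicators $u_i^t\in\{0,1\}$ encode the updating rule; write $w_i^t:=u_i^tv_i^t$. Parallel updating: $u_i^t\equiv1$. Sequential updating: at each time exactly one $u_i^t$ equals $1$, the others being $0$, chosen by one of two rules: (random sequential) the index is chosen at random at each time, independently, according to a given distribution $q=(q_1,\dots,q_n)$ with $\prod_i q_i>0$;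 (deterministic sequential) starting from a certain index, particles are updated clockwise (in increasing order of index modulo $n$) one at a time, cyclically. Dynamics (natural resolution of conflicts). $x_i^{t+1}=x_i^t+d_i^t$, where each particle moves with its velocity as far as possible: - if $w_i^t=0$ then $d_i^t=0$; - if $w_i^t>0$ and $w_{i+1}^t\ge0$ then $d_i^t=\min\{w_i^t,\Delta_i^t\}$; if $w_i^t<0$ and $w_{i-1}^t\le 0$ then $d_i^t=\max\{w_i^t,-\Delta_{i-1}^t\}$; - if $w_i^t>0>w_{i+1}^t$ then, when $w_i^t-w_{i+1}^t\le\Delta_i^t$, $d_i^t=w_i^t$ and $d_{i+1}^t=w_{i+1}^t$; and when $w_i^t-w_{i+1}^t>\Delta_i^t$ (mutual conflict), $$d_i^t=\frac{\Delta_i^tw_i^t}{w_i^t-w_{i+1}^t},\qquad d_{i+1}^t=\frac{\Delta_i^tw_{i+1}^t}{w_i^t-w_{i+1}^t}.$$ Consequently $\Delta_i^{t+1}=\Delta_i^t-d_i^t+d_{i+1}^t$. Unique ergodicity of $\Delta^t$ means: for each admissible initial $\Delta^0$ the distributions of $\Delta^t$ converge (weakly) as $t\to\infty$ in Cesàro means to a limit which does not depend on $\Delta^0$. *)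

(* Defs.v *)
(* MathComp world, with MathComp-Analysis. *)
From HB Require Import structures.
From mathcomp Require Import all_boot all_order all_algebra.
From mathcomp Require Import all_classical all_reals all_analysis.

Set Implicit Arguments.
Unset Strict Implicit.
Unset Printing Implicit Defensive.

Import Order.TTheory GRing.Theory Num.Theory.
Import numFieldNormedType.Exports.

Local Open Scope classical_set_scope.
Local Open Scope ring_scope.

(* Particles are indexed by 'I_n, with i + 1 and i - 1 modulo n rendered by
   ordS i and ord_pred i. Displacements depend on the positions only through
   the gaps, so the gaps D 0 i (from particle i clockwise to particle i + 1)
   are the state of the system. *)

Definition admissible (R : realType) (n : nat) (r : 'I_n -> R)
    (D : 'rV[R]_n) : Prop :=
  (forall i, 0 <= D 0 i) /\ \sum_(i < n) (D 0 i + 2 * r i) = 1.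

(* The displacement d_i for effective velocities w and gaps D. A particle with
   w i > 0 is the left partner of a possible mutual conflict over the gap D_i,
   one with w i < 0 the right partner of a possible conflict over D_(i-1). *)
Definition displacement (R : realType) (n : nat) (w : 'I_n -> R)
    (D : 'rV[R]_n) (i : 'I_n) : R :=
  let j := ordS i in
  let k := ord_pred i in
  if w i == 0 then 0
  else if 0 < w i then
    if 0 <= w j then Num.min (w i) (D 0 i)
    else if w i - w j <= D 0 i then w i
    else D 0 i * w i / (w i - w j)
  else
    if w k <= 0 then Num.max (w i) (- D 0 k)
    else if w k - w i <= D 0 k then w i
    else D 0 k * w i / (w k - w i).

Definition gap_step (R : realType) (n : nat) (w : 'I_n -> R)
    (D : 'rV[R]_n) : 'rV[R]_n :=
  \row_(i < n) (D 0 i - displacement w D i + displacement w D (ordS i)).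

(* Multiplicators: u t i x is the 0/1 value of u_i^t at the sample point x. *)
Definition multiplicators (n : nat) (T : Type) := nat -> 'I_n -> T -> bool.

Definition parallel (n : nat) (T : Type) : multiplicators n T :=
  fun _ _ _ => true.

Definition one_at_a_time (n : nat) (T : Type) (kappa : nat -> T -> 'I_n) :
  multiplicators n T := fun t i x => i == kappa t x.

Definition clockwise (n : nat) (T : Type) (i0 : 'I_n) : multiplicators n T :=
  one_at_a_time (fun t (_ : T) => iter t (@ordS n) i0).

Fixpoint gaps (R : realType) (n : nat) (T : Type)
    (v : nat -> 'I_n -> T -> R) (u : multiplicators n T) (D0 : 'rV[R]_n)
    (t : nat) (x : T) : 'rV[R]_n :=
  if t is s.+1 then
    gap_step (fun i => (u s i x)%:R * v s i x) (gaps v u D0 s x)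
  else D0.

(* F i is the collection of events carried by the i-th member of the family. *)
Definition mutually_independent (R : realType) (d : measure_display)
    (T : measurableType d) (P : probability T R) (I : choiceType)
    (F : I -> set (set T)) : Prop :=
  forall (J : seq I) (E : I -> set T), uniq J ->
    (forall j, j \in J -> F j (E j)) ->
    P (\bigcap_(j in [set` J]) E j) = (\prod_(j <- J) P (E j))%E.

Definition velocity_events (R : realType) (d : measure_display)
    (T : measurableType d) (P : probability T R) (n : nat)
    (v : nat -> 'I_n -> {RV P >-> R}) (a : nat * 'I_n) : set (set T) :=
  preimage_set_system setT (v a.1 a.2) measurable.

Definition local_velocities (R : realType) (d : measure_display)
    (T : measurableType d) (P : probability T R) (n : nat)
    (law : 'I_n -> probability R R) (v : nat -> 'I_n -> {RV P >-> R}) : Prop :=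
  [/\ mutually_independent P (velocity_events v),
      forall t i A, measurable A -> distribution P (v t i) A = law i A &
      forall i, law i `[-1, 1]%classic = 1%E].

(* kappa t is the index updated at time t. The indices are independent of each
   other and of all the local velocities. *)
Definition random_index (R : realType) (d : measure_display)
    (T : measurableType d) (P : probability T R) (n : nat)
    (v : nat -> 'I_n -> {RV P >-> R}) (q : 'I_n -> R)
    (kappa : nat -> T -> 'I_n) : Prop :=
  [/\ [/\ forall i, 0 <= q i, \sum_(i < n) q i = 1 & 0 < \prod_(i < n) q i],
      forall t i, measurable (kappa t @^-1` [set i]),
      forall t i, P (kappa t @^-1` [set i]) = (q i)%:E &
      mutually_independent P (fun a : (nat * 'I_n) + nat =>
        match a with
        | inl b => velocity_events v b
        | inr t => preimage_set_system setT (kappa t) setT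
        end)].

(* Velocities of both signs: neither sign is excluded for the whole system (a
   single particle may still be one-signed). Without this the deterministic
   sequential case fails: if every velocity is at least the total gap length,
   a full clockwise round maps the gaps (a_1, ..., a_(n-1), 0) to
   (a_2, ..., a_(n-1), a_1, 0), whatever the exact velocities are. *)
Definition both_signs (R : realType) (n : nat)
    (law : 'I_n -> probability R R) : Prop :=
  (exists i, (0 < law i [set z : R | (0 < z)%R])%E) /\
  (exists i, (0 < law i [set z : R | (z < 0)%R])%E).

(* Weak convergence in Cesaro means; the limit is a Borel probability on R^n,
   and the integral of f against the law of the gaps at time t is written as
   the expectation of f along the process. *)
Definition uniquely_ergodic (R : realType) (d : measure_display)
    (T : measurableType d) (P : probability T R) (n : nat) (r : 'I_n -> R)
    (v : nat -> 'I_n -> {RV P >-> R}) (u : multiplicators n T) : Prop :=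
  exists mu : probability (g_sigma_algebraType (@open 'rV[R]_n)) R,
  forall D0 : 'rV[R]_n, admissible r D0 ->
  forall f : 'rV[R]_n -> R, continuous f -> bounded_fun f ->
    arithmetic_mean (fun t : nat => \int[P]_x f (gaps v u D0 t x)) @ \oo
      --> \int[mu]_y f y.

(* Main.v *)
(** Run the process backwards: the state after t steps has the same law when
    the noise of the steps 0, ..., t - 1 is read in reversed order. Then a longer
    run only inserts steps before those of a shorter one, so once some block of
    the shorter run maps all admissible gaps to a single state, lengthening the
    run by multiples of the block length no longer changes its final state.

    Such a synchronizing block has positive probability. The comparison
    hypothesis and the presence of both signs yield a particle b that has
    v <= 0 with positive probability while all the others can have v > eps (or
    the mirror image). While this sign pattern lasts, no mass leaves the gap to
    the right of b, and the other gaps are drained towards it one after the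
    other, starting with the gap to the left of b; after a bounded number of
    rounds all the mass is in that single gap. Disjoint blocks being independent,
    almost surely some block is synchronizing, so the backward process becomes
    constant along each residue class of times modulo the block length. The
    average of the laws of these finitely many limits is the Cesaro limit of the
    laws of the gaps, whatever the initial gaps. *)

Require Import Defs.
From HB Require Import structures.
From mathcomp Require Import all_boot all_order all_algebra.
From mathcomp Require Import all_classical all_reals all_analysis.
From mathcomp Require Import measurable_realfun ring lra zify.

Set Implicit Arguments.
Unset Strict Implicit.
Unset Printing Implicit Defensive.

Import Order.TTheory GRing.Theory Num.Theory.
Import numFieldNormedType.Exports.

Local Open Scope classical_set_scope.
Local Open Scope ring_scope.

(** * Deterministic gap dynamics *)

Section cyclic_order.
Variable n : nat.

Lemma val_iter_ordS k (i : 'I_n) : iter k (@ordS n) i = ((i + k) %% n)%N :> nat.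
Proof.
elim: k => [|k IHk] /=; first by rewrite addn0 modn_small.
by rewrite IHk -addn1 modnDml addn1 addnS.
Qed.

Lemma iter_ordS_neq k (i : 'I_n) : (0 < k < n)%N -> iter k (@ordS n) i != i.
Proof.
move=> /andP[k0 kn]; apply/eqP => /(congr1 (@nat_of_ord n)).
rewrite val_iter_ordS => /eqP; apply/negP.
have := ltn_ord i => lin; case: (ltnP (i + k) n) => ik.
  by rewrite modn_small //; lia.
have -> : (i + k = (i + k - n) + n)%N by rewrite subnK.
rewrite modnDr modn_small; lia.
Qed.

Lemma iter_ordS_period (i : 'I_n) : iter n (@ordS n) i = i.
Proof. by apply: ord_inj; rewrite val_iter_ordS modnDr modn_small. Qed.

Lemma ordS_reach (i j : 'I_n) : exists2 k, (k < n)%N & iter k (@ordS n) i = j.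
Proof.
have [lin ljn] := (ltn_ord i, ltn_ord j).
exists ((j + n - i) %% n)%N; first by rewrite ltn_mod; lia.
apply: ord_inj; rewrite val_iter_ordS modnDmr.
have -> : (i + (j + n - i) = j + n)%N by lia.
by rewrite modnDr modn_small.
Qed.

Lemma iter_ord_predK k : cancel (iter k (@ordS n)) (iter k (@ord_pred n)).
Proof. by elim: k => [|k IHk] i //; rewrite iterSr iterS ordSK IHk. Qed.

Lemma iter_ordSK k : cancel (iter k (@ord_pred n)) (iter k (@ordS n)).
Proof. by elim: k => [|k IHk] i //; rewrite iterSr iterS ord_predK IHk. Qed.

Lemma ord_pred_reach (i j : 'I_n) :
  exists2 k, (k < n)%N & iter k (@ord_pred n) i = j.
Proof.
by have [k kn <-] := ordS_reach j i; exists k; rewrite ?iter_ord_predK.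
Qed.

Lemma iter_ord_pred_neq k (i : 'I_n) :
  (0 < k < n)%N -> iter k (@ord_pred n) i != i.
Proof.
by move=> /(iter_ordS_neq i); apply: contra => /eqP {1}<-; rewrite iter_ordSK.
Qed.

Lemma iter_ord_pred_period (i : 'I_n) : iter n (@ord_pred n) i = i.
Proof. by rewrite -{1}[i]iter_ordS_period iter_ord_predK. Qed.

End cyclic_order.

(** * One step of the gap dynamics *)

Section gap_dynamics.
Context (R : realType) (n : nat).
Implicit Types (w : 'I_n -> R) (D : 'rV[R]_n) (i b : 'I_n).

Lemma displacement0 w D i : w i = 0 -> displacement w D i = 0.
Proof. by rewrite /displacement => ->; rewrite eqxx. Qed.

Lemma displacement_gt0 w D i (wi : 0 < w i) : displacement w D i =
  if 0 <= w (ordS i) then Num.min (w i) (D 0 i)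
  else if w i - w (ordS i) <= D 0 i then w i
  else D 0 i * w i / (w i - w (ordS i)).
Proof. by rewrite /displacement gt_eqF// wi. Qed.

Lemma displacement_lt0 w D i (wi : w i < 0) : displacement w D i =
  if w (ord_pred i) <= 0 then Num.max (w i) (- D 0 (ord_pred i))
  else if w (ord_pred i) - w i <= D 0 (ord_pred i) then w i
  else D 0 (ord_pred i) * w i / (w (ord_pred i) - w i).
Proof. by rewrite /displacement lt_eqF// ltNge (ltW wi). Qed.

Lemma displacement_ge0 w D i :
  (forall j, 0 <= D 0 j) -> 0 <= w i -> 0 <= displacement w D i.
Proof.
move=> D0; rewrite le_eqVlt => /predU1P[wi|wi].
  by rewrite displacement0.
rewrite displacement_gt0//; case: ifP => [_|/negbT].
  by rewrite le_min D0 ltW.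
rewrite -ltNge => wj; case: ifP => _; first exact: ltW.
by rewrite divr_ge0 ?mulr_ge0 ?D0 ?subr_ge0 ?(ltW wi)// ltW// (lt_trans wj).
Qed.

Lemma displacement_le0 w D i :
  (forall j, 0 <= D 0 j) -> w i <= 0 -> displacement w D i <= 0.
Proof.
move=> D0; rewrite le_eqVlt => /predU1P[wi|wi].
  by rewrite displacement0.
rewrite displacement_lt0//; case: ifP => [_|/negbT].
  by rewrite ge_max (ltW wi) oppr_le0 D0.
rewrite -ltNge => wj; case: ifP => _; first exact: ltW.
rewrite -mulrA mulr_ge0_le0 ?D0// mulr_le0_ge0 ?(ltW wi)//.
by rewrite invr_ge0 subr_ge0 ltW// (lt_trans wi).
Qed.

Lemma displacement_le_gap w D i :
  (forall j, 0 <= D 0 j) -> 0 <= w (ordS i) -> displacement w D i <= D 0 i.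
Proof.
move=> D0 wj; have [wi|wi] := leP (w i) 0.
  exact: le_trans (displacement_le0 D0 wi) (D0 i).
by rewrite displacement_gt0// ifT// ge_min lexx orbT.
Qed.

Lemma displacement_ge_gap w D i : (forall j, 0 <= D 0 j) ->
  w i <= 0 -> - D 0 i <= displacement w D (ordS i).
Proof.
move=> D0 wi; have [wj|wj] := leP 0 (w (ordS i)).
  by rewrite (le_trans _ (displacement_ge0 D0 wj))// oppr_le0.
by rewrite displacement_lt0// ordSK ifT// le_max lexx orbT.
Qed.

(** In a mutual conflict the two displacements are proportional to the velocities and close the gap
    exactly; otherwise the gap shrinks by the closing speed. The maximum covers both cases. *)
Lemma gap_step_conflict w D i : w (ordS i) < 0 -> 0 < w i ->
  gap_step w D 0 i = Num.max 0 (D 0 i - (w i - w (ordS i))).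
Proof.
move=> wj wi; rewrite mxE displacement_gt0// displacement_lt0// ordSK.
rewrite ifF; last by apply/negbTE; rewrite -ltNge.
rewrite [X in _ + X]ifF; last by apply/negbTE; rewrite -ltNge.
case: leP => h; first by rewrite max_r; lra.
rewrite max_l ?subr_le0 1?ltW//; field.
by rewrite gt_eqF// subr_gt0 (lt_trans wj).
Qed.

(** Unless its two particles approach each other, one displacement does not shrink the gap and the
    other shrinks it by at most its length. *)
Lemma gap_step_ge0 w D :
  (forall i, 0 <= D 0 i) -> forall i, 0 <= gap_step w D 0 i.
Proof.
move=> D0 i; have [wj|wj] := leP 0 (w (ordS i)).
  rewrite mxE; have := displacement_le_gap D0 wj.
  by have := displacement_ge0 D0 wj; lra.
have [wi|wi] := leP (w i) 0; last by rewrite gap_step_conflict// le_max lexx.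
rewrite mxE; have := displacement_ge_gap D0 wi.
by have := displacement_le0 D0 wi; lra.
Qed.

Lemma gap_step_admissible (r : 'I_n -> R) w D :
  admissible r D -> admissible r (gap_step w D).
Proof.
move=> [D0 D1]; split; first exact: gap_step_ge0.
rewrite -[RHS]D1 !big_split/=; congr +%R.
under eq_bigr do rewrite mxE.
rewrite !big_split/= -[RHS]addr0 -addrA sumrN; congr +%R.
rewrite addrC; apply/eqP; rewrite subr_eq0; apply/eqP.
by rewrite [RHS](reindex (@ordS n))//; apply: onW_bij; exact: ordS_bij.
Qed.

Lemma admissible_le1 (r : 'I_n -> R) D i :
  (forall j, 0 <= r j) -> admissible r D -> D 0 i <= 1.
Proof.
move=> r0 [D0 <-]; rewrite (bigD1 i)//= -addrA lerDl addr_ge0 ?mulr_ge0//.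
by apply: sumr_ge0 => j _; rewrite addr_ge0 ?mulr_ge0.
Qed.

(** The left particle [i] takes as much of the gap as [w i] allows, and the right one does not give
    way: it is either [b], which does not move right, or it is blocked by the empty gap in front of
    it. *)
Lemma gap_step_drain_right b w D i : (forall j, 0 <= D 0 j) ->
  w b <= 0 -> (forall j, j != b -> 0 <= w j) -> i != b ->
  (ordS i != b -> D 0 (ordS i) = 0) ->
  gap_step w D 0 i <= Num.max 0 (D 0 i - w i).
Proof.
move=> D0 wb w0 ib Dj; have wi := w0 _ ib.
have di : Num.min (w i) (D 0 i) <= displacement w D i \/
    w (ordS i) < 0 /\ 0 < w i.
  move: wi; rewrite le_eqVlt => /predU1P[wi|wi].
    by left; rewrite displacement0// -wi ge_min lexx.
  have [wj|wj] := ltP (w (ordS i)) 0; first by right.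
  by left; rewrite displacement_gt0// ifT.
case: di => [di|[wj wi0]]; last first.
  by rewrite gap_step_conflict// ge_max !le_max lexx/=; apply/orP; right; lra.
have dj : displacement w D (ordS i) <= 0.
  have [jb|jb] := eqVneq (ordS i) b; first by rewrite jb displacement_le0.
  have [wk|wk] := leP 0 (w (ordS (ordS i))).
    by rewrite -(Dj jb) displacement_le_gap.
  move: (w0 _ jb); rewrite le_eqVlt => /predU1P[wj|wj].
    by rewrite displacement0.
  by rewrite displacement_gt0// Dj// !mul0r;
    case: ifP => [|_]; [lra|case: ifP; lra].
rewrite mxE; move: di; rewrite minEle maxEle; case: ifP; case: ifP; lra.
Qed.

(** Mirror image of [gap_step_drain_right]: the right particle [ordS i] consumes the gap, while [i]
    is either [b] or blocked by the empty gap behind it. *)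
Lemma gap_step_drain_left b w D i : (forall j, 0 <= D 0 j) ->
  0 <= w b -> (forall j, j != b -> w j <= 0) -> ordS i != b ->
  (i != b -> D 0 (ord_pred i) = 0) ->
  gap_step w D 0 i <= Num.max 0 (D 0 i + w (ordS i)).
Proof.
move=> D0 wb w0 ib Dj; have wj := w0 _ ib.
have dj : displacement w D (ordS i) <= Num.max (w (ordS i)) (- D 0 i) \/
    w (ordS i) < 0 /\ 0 < w i.
  move: wj; rewrite le_eqVlt => /predU1P[wj|wj].
    by left; rewrite displacement0// wj le_max lexx.
  have [wi|wi] := ltP 0 (w i); first by right.
  by left; rewrite displacement_lt0// ordSK ifT.
case: dj => [dj|[wj0 wi]]; last first.
  by rewrite gap_step_conflict// ge_max !le_max lexx/=; apply/orP; right; lra.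
have di : 0 <= displacement w D i.
  have [jb|jb] := eqVneq i b; first by rewrite jb displacement_ge0.
  have [wk|wk] := leP (w (ord_pred i)) 0.
    by have := displacement_ge_gap D0 wk; rewrite ord_predK (Dj jb) oppr0.
  move: (w0 _ jb); rewrite le_eqVlt => /predU1P[wi|wi].
    by rewrite displacement0.
  by rewrite displacement_lt0// Dj// !mul0r;
    case: ifP => [|_]; [lra|case: ifP; lra].
rewrite mxE; move: dj; rewrite !maxEle; case: ifP; case: ifP; lra.
Qed.

End gap_dynamics.

(** * Runs driven by a given sequence of effective velocities *)

Section runs.
Context (R : realType) (n : nat).
Implicit Types (w : nat -> 'I_n -> R) (D : 'rV[R]_n).

(** The dynamics without sample points, so that one and the same function can be fed with the
    original noise and with the time-reversed noise. *)
Fixpoint run w D (t : nat) : 'rV[R]_n :=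
  if t is s.+1 then gap_step (w s) (run w D s) else D.

Lemma gapsE (T : Type) (v : nat -> 'I_n -> T -> R) u D t x :
  gaps v u D t x = run (fun s i => (u s i x)%:R * v s i x) D t.
Proof. by elim: t => //= t ->. Qed.

Lemma eq_run w w' D t :
  (forall s, (s < t)%N -> w s = w' s) -> run w D t = run w' D t.
Proof.
elim: t => //= t IHt ww'; rewrite ww'// IHt// => s st.
by rewrite ww'// ltnS ltnW.
Qed.

Lemma run_add w D s t :
  run w D (s + t) = run (fun k => w (s + k)%N) (run w D s) t.
Proof. by elim: t => [|t IHt]; rewrite ?addn0// addnS /= IHt. Qed.

Lemma run_admissible (r : 'I_n -> R) w D t :
  admissible r D -> admissible r (run w D t).
Proof. by move=> aD; elim: t => //= t; exact: gap_step_admissible. Qed.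

End runs.

(** * Synchronization *)

Section draining.
Context (R : realType).

Lemma drain_mono (h a : nat -> R) s0 : (forall s, 0 <= h s) ->
  (forall s, 0 <= a s) ->
  (forall s, (s0 <= s)%N -> h s.+1 <= Num.max 0 (h s - a s)) ->
  forall s s', (s0 <= s <= s')%N -> h s' <= h s.
Proof.
move=> h0 a0 ha s s' /andP[s0s ss'].
rewrite -(subnKC ss'); elim: (s' - s)%N => [|k IHk]; first by rewrite addn0.
rewrite addnS (le_trans _ IHk)//.
rewrite (le_trans (ha _ _)) ?(leq_trans s0s) ?leq_addr//.
by rewrite ge_max h0/= gerBl.
Qed.

(* Reservoir k is only fed by reservoirs of higher rank, so the ranks are
   exhausted one after the other, from n - 1 down to 1. *)
Lemma drain (h a : nat -> nat -> R) (n M : nat) (eps : R) :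
  (forall s k, 0 <= h s k <= 1) ->
  (forall s k, (0 < k < n)%N -> 0 <= a s k) ->
  (forall s k, (0 < k < n)%N -> (forall j, (k < j < n)%N -> h s j = 0) ->
     h s.+1 k <= Num.max 0 (h s k - a s k)) ->
  (forall c k, (0 < k < n)%N ->
     exists2 s, (c * n <= s < c.+1 * n)%N & eps <= a s k) ->
  1 <= eps * M%:R ->
  forall k, (0 < k < n)%N -> h (n * M * n)%N k = 0.
Proof.
move=> h01 a0 ha act epsM.
have h0 s k : 0 <= h s k by have /andP[] := h01 s k.
(* Induction on the number [m] of exhausted ranks, counted from the top; each of them costs [M]
   rounds of [n] steps. *)
suff drained m : (m <= n)%N -> forall s k, (m * M * n <= s)%N ->
    (n - m <= k < n)%N -> (0 < k)%N -> h s k = 0.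
  by move=> k /andP[k0 kn]; apply: (drained n); rewrite ?leqnn ?subnn.
elim: m => [|m IHm] mn s k ss /andP[mk kn] k0; first by lia.
have {}IHm := IHm (ltnW mn).
have [mk'|mk'] := leqP (n - m)%N k.
  by apply: IHm => //; [apply: leq_trans ss; rewrite !leq_mul|rewrite mk'].
have k0n : (0 < k < n)%N by rewrite k0.
have hk t : (m * M * n <= t)%N -> h t.+1 k <= Num.max 0 (h t k - a t k).
  move=> mt; apply: ha => // j /andP[kj jn].
  by apply: IHm => //; [rewrite jn andbT; lia|lia].
have mono := drain_mono (h0 ^~ k) (fun t => a0 t k k0n) hk.
(* Every round contains a step that withdraws at least [eps], and no step adds anything, so [M]
   rounds exhaust a content of at most 1. *)
have round c : (c <= M)%N ->
    h ((m * M + c) * n)%N k <= Num.max 0 (1 - eps * c%:R).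
  elim: c => [|c IHc] cM.
    rewrite mulr0 subr0 le_max.
    by have /andP[_ ->] := h01 ((m * M + 0) * n)%N k; rewrite orbT.
  have [t /andP[ct tc] at_] := act (m * M + c)%N k k0n.
  have mt : (m * M * n <= t)%N.
    by apply: leq_trans ct; rewrite leq_mul2r leq_addr orbT.
  have h1 : h ((m * M + c.+1) * n)%N k <= h t.+1 k.
    by apply: mono; rewrite (leqW mt) addnS.
  have h2 := hk t mt.
  have h3 : h t k <= h ((m * M + c) * n)%N k.
    by apply: mono; rewrite ct andbT leq_mul2r leq_addr orbT.
  have := IHc (ltnW cM); rewrite -[c.+1]addn1 natrD mulrDr mulr1.
  rewrite addn1 => h4; apply: (le_trans h1); apply: (le_trans h2).
  rewrite ge_max le_max lexx/=.
  have eps0 : 0 <= eps.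
    rewrite leNgt; apply/negP => eps0; suff : eps * M%:R <= 0 by lra.
    by rewrite mulr_le0_ge0 ?ler0n// ltW.
  by move: h4; rewrite !maxEle; case: ifP; case: ifP; lra.
have /le_trans hs : h s k <= h ((m * M + M) * n)%N k.
  by apply: mono; rewrite leq_mul2r leq_addr orbT/=; move: ss; rewrite mulSnr.
apply/le_anti; rewrite h0 andbT; apply: hs.
by apply: (le_trans (round M (leqnn _))); rewrite ge_max lexx subr_le0.
Qed.

End draining.

(** * Sign patterns that merge all admissible states *)

Section synchronization.
Context (R : realType) (n : nat) (r : 'I_n -> R).
Hypothesis r_ge0 : forall i, 0 <= r i.
Implicit Types (H : 'I_n -> set R) (w : nat -> 'I_n -> R) (b : 'I_n).

(* Effective velocities: 0 is the value of a particle that is not updated. *)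
Definition active_each_round H w :=
  (forall s i, w s i = 0 \/ H i (w s i)) /\
  (forall c i, exists2 s, (c * n <= s < c.+1 * n)%N & H i (w s i)).

Definition synchronizing H (K : nat) := forall w, active_each_round H w ->
  forall D D', admissible r D -> admissible r D' -> run w D K = run w D' K.

(** Named after the side of [b] on which the mass gathers: its right gap [b] here, its left gap
    [ord_pred b] in [toward_left_of]. The margin [eps] bounds the time needed to drain the other
    gaps. *)
Definition toward_right_of b (eps : R) (i : 'I_n) : set R :=
  if i == b then [set z | z <= 0] else [set z | eps < z].

Definition toward_left_of b (eps : R) (i : 'I_n) : set R :=
  if i == b then [set z | 0 <= z] else [set z | z < - eps].

(** The prescribed total length determines the one gap that may be nonzero. *)
Lemma admissible_concentrated_eq (g : 'I_n) (D D' : 'rV[R]_n) :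
  admissible r D -> admissible r D' ->
  (forall i, i != g -> D 0 i = 0) -> (forall i, i != g -> D' 0 i = 0) ->
  D = D'.
Proof.
move=> [_ D1] [_ D1'] Dg Dg'; apply/rowP => i.
have [->|ig] := eqVneq i g; last by rewrite Dg ?Dg'.
move: D1'; rewrite -[RHS]D1 !big_split/= => /addIr.
by rewrite (bigD1 g)//= [RHS](bigD1 g)//= !big1// !addr0.
Qed.

Section drain_system.
Variables (D : 'rV[R]_n) (w : nat -> 'I_n -> R) (aD : admissible r D).

Let run01 s i : 0 <= run w D s 0 i <= 1.
Proof.
have aR := run_admissible w s aD.
by rewrite (admissible_le1 _ _ aR)// andbT; case: aR.
Qed.

(** An instance of [drain]: the rank of a gap is its clockwise distance from gap [b], so the gap
    just left of [b] is emptied first. *)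
Lemma drained_right b eps M : 0 < eps -> 1 <= eps * M%:R ->
  active_each_round (toward_right_of b eps) w ->
  forall i, i != b -> run w D (n * M * n) 0 i = 0.
Proof.
move=> eps0 epsM [wH wact] i ib.
have neq k : (0 < k < n)%N -> iter k (@ordS n) b != b by exact: iter_ordS_neq.
have w_ge0 s j : j != b -> 0 <= w s j.
  move=> jb; case: (wH s j) => [->//|]; rewrite /toward_right_of (negbTE jb)/=.
  by move=> /(lt_trans eps0)/ltW.
have w_le0 s : w s b <= 0.
  by case: (wH s b) => [->//|]; rewrite /toward_right_of eqxx.
have [k kn ik] := ordS_reach b i; rewrite -ik.
have k0n : (0 < k < n)%N.
  by rewrite kn andbT; case: k ik {kn} => [e|//]; rewrite -e eqxx in ib.
move: k k0n {kn ik ib i}; apply: (@drain R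
  (fun s k => run w D s 0 (iter k (@ordS n) b))
  (fun s k => w s (iter k (@ordS n) b)) n M eps) => //.
- by move=> s k /neq/w_ge0.
- move=> s k k0n empty /=; apply: (@gap_step_drain_right R n b) => //.
  + by move=> j; have /andP[] := run01 s j.
  + exact: w_ge0.
  + exact: neq.
  (* In rank [n - 1] the particle to the right is [b] itself, so here [k.+1 < n]. *)
  + move=> Sb; apply: (empty k.+1); rewrite ltnSn/=.
    have /andP[_] := k0n; rewrite leq_eqVlt => /predU1P[kn|//].
    by move: Sb; rewrite -iterS kn iter_ordS_period eqxx.
- move=> c k /neq kb; have [s cs Hs] := wact c (iter k (@ordS n) b).
  by exists s => //; move: Hs; rewrite /toward_right_of (negbTE kb) => /ltW.
Qed.

Lemma drained_left b eps M : 0 < eps -> 1 <= eps * M%:R ->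
  active_each_round (toward_left_of b eps) w ->
  forall i, i != ord_pred b -> run w D (n * M * n) 0 i = 0.
Proof.
move=> eps0 epsM [wH wact] i ib.
(* Ranks now run counterclockwise from [ord_pred b], and gap [g k] is drained by its right particle
   [ordS (g k)]. *)
pose g k : 'I_n := iter k (@ord_pred n) (ord_pred b).
have Sg k : ordS (g k) = iter k (@ord_pred n) b.
  by rewrite /g -iterSr iterS ord_predK.
have neq k : (0 < k < n)%N -> ordS (g k) != b.
  by rewrite Sg; exact: iter_ord_pred_neq.
have w_le0 s j : j != b -> w s j <= 0.
  move=> jb; case: (wH s j) => [->//|]; rewrite /toward_left_of (negbTE jb)/=.
  by move=> h; apply/ltW/(lt_le_trans h); rewrite oppr_le0 ltW.
have w_ge0 s : 0 <= w s b.
  by case: (wH s b) => [->//|]; rewrite /toward_left_of eqxx.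
have [k kn ik] := ord_pred_reach (ord_pred b) i; rewrite -ik.
have k0n : (0 < k < n)%N.
  by rewrite kn andbT; case: k ik {kn} => [e|//]; rewrite -e eqxx in ib.
move: k k0n {kn ik ib i}; apply: (@drain R
  (fun s k => run w D s 0 (g k)) (fun s k => - w s (ordS (g k))) n M eps) => //.
- by move=> s k /neq/w_le0; rewrite oppr_ge0; apply.
- move=> s k k0n empty /=; rewrite opprK.
  apply: (@gap_step_drain_left R n b) => //.
  + by move=> j; have /andP[] := run01 s j.
  + exact: w_le0.
  + exact: neq.
  + move=> Sb; apply: (empty k.+1); rewrite ltnSn/=.
    have /andP[_] := k0n; rewrite leq_eqVlt => /predU1P[kn|//].
    by move: Sb; rewrite /g -iterSr kn iter_ord_pred_period eqxx.
- move=> c k /neq kb; have [s cs Hs] := wact c (ordS (g k)).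
  exists s => //; move: Hs; rewrite /toward_left_of (negbTE kb)/= => h.
  by rewrite lerNr ltW.
Qed.

End drain_system.

Lemma synchronizing_right b eps M : 0 < eps -> 1 <= eps * M%:R ->
  synchronizing (toward_right_of b eps) (n * M * n).
Proof.
move=> eps0 epsM w aw D D' aD aD'.
apply: (admissible_concentrated_eq (g := b)); try exact: run_admissible.
  exact: drained_right aw.
exact: drained_right aw.
Qed.

Lemma synchronizing_left b eps M : 0 < eps -> 1 <= eps * M%:R ->
  synchronizing (toward_left_of b eps) (n * M * n).
Proof.
move=> eps0 epsM w aw D D' aD aD'.
apply: (admissible_concentrated_eq (g := ord_pred b));
  try exact: run_admissible.
  exact: drained_left aw.
exact: drained_left aw.
Qed.

End synchronization.

(** * Laws of families of independent random variables *)

Lemma probability_bounded_integrable d (T : measurableType d) (R : realType)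
    (P : probability T R) (f : T -> R) (M : R) : measurable_fun setT f ->
  (forall x, `|f x| <= M) -> P.-integrable setT (EFin \o f).
Proof.
move=> mf fM; apply: measurable_bounded_integrable => //.
  by rewrite -ge0_fin_numE ?fin_num_measure.
exists M; split; first exact: num_real.
by move=> N /ltW MN x _; exact: le_trans MN.
Qed.

Section law_transport.
Context d d' (T : measurableType d) (U : measurableType d') (R : realType).
Variable P : probability T R.

Lemma eq_law_Rintegral (X X' : T -> U) (f : U -> R) (M : R) :
  measurable_fun setT X -> measurable_fun setT X' ->
  (forall A, measurable A -> P (X @^-1` A) = P (X' @^-1` A)) ->
  measurable_fun setT f -> (forall y, `|f y| <= M) ->
  \int[P]_x f (X x) = \int[P]_x f (X' x).
Proof.
move=> mX mX' XX' mf fM; congr fine.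
have int_comp (Y : T -> U) : measurable_fun setT Y ->
    P.-integrable setT (EFin \o (f \o Y)).
  move=> mY; apply: (@probability_bounded_integrable _ _ _ _ _ M).
    exact: measurableT_comp.
  by move=> x; exact: fM.
pose EX : {mfun T >-> U} := HB.pack X (isMeasurableFun.Build _ _ _ _ _ mX).
pose EX' : {mfun T >-> U} := HB.pack X' (isMeasurableFun.Build _ _ _ _ _ mX').
have push (V : {mfun T >-> U}) :
    (\int[pushforward P V]_y (f y)%:E = \int[P]_x (f (V x))%:E)%E.
  rewrite integral_pushforward ?preimage_setT//.
    by apply/measurable_EFinP.
  exact: int_comp.
rewrite -(push EX) -(push EX'); apply: eq_measure_integral => A mA _.
exact: XX'.
Qed.

End law_transport.

(** * Product sigma-algebra and joint laws *)

Section cylinders.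
Context (I : choiceType) (R : realType).

(** Finite-dimensional rectangles, with a side for every coordinate that is the whole line outside
    [J]. Intersections are then taken side by side, which makes this a pi-system; it generates the
    product sigma-algebra of [noise]. *)
Definition cylinder : set (set (I -> R)) := [set A | exists J B,
  [/\ uniq J, forall a, measurable (B a : set R),
      forall a, a \notin J -> B a = setT & A = [set y | forall a, B a (y a)]]].

Lemma cylinder_setI : setI_closed cylinder.
Proof.
move=> _ _ [J [B [uJ mB BJ ->]]] [J' [B' [uJ' mB' BJ' ->]]].
exists (undup (J ++ J')), (fun a => B a `&` B' a); split.
- exact: undup_uniq.
- by move=> a; exact: measurableI.
- move=> a; rewrite mem_undup mem_cat negb_or => /andP[/BJ -> /BJ' ->].
  by rewrite setIT.
- by apply/seteqP; split=> [y [h h'] a|y h]; [split|split=> a; have [] := h a].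
Qed.

Definition noise : measurableType cylinder.-sigma :=
  g_sigma_algebraType cylinder.

Definition family (T : Type) (Z : I -> T -> R) (x : T) : noise :=
  fun a => Z a x.

Lemma measurable_coordinate (a : I) :
  measurable_fun setT (fun y : noise => (y : I -> R) a).
Proof.
move=> _ B mB; rewrite setTI; apply: sub_sigma_algebra.
exists [:: a], (fun b => if b == a then B else setT); split => //.
- by move=> b; case: ifP.
- by move=> b; rewrite inE => /negbTE ->.
- apply/seteqP; split=> [y By b|y /(_ a)]; last by rewrite eqxx.
  by case: eqP => // ->.
Qed.

End cylinders.
Arguments cylinder : clear implicits.
Arguments noise : clear implicits.

Section law_of_family.
Context d (T : measurableType d) (R : realType) (I : choiceType).

Lemma measurable_family (Z : I -> T -> R) :
  (forall a, measurable_fun setT (Z a)) -> 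
  measurable_fun setT (family Z).
Proof.
move=> mZ.
apply: (@measurability d _ T (noise I R) setT (family Z) (cylinder I R)) => //.
move=> _ [_ [J [B [uJ mB BJ ->]]] <-]; rewrite setTI.
rewrite (_ : _ @^-1` _ = \bigcap_(a in [set` J]) (Z a @^-1` B a)).
  apply: fin_bigcap_measurable => // a _.
  by rewrite -[X in measurable X]setTI; exact: mZ.
apply/seteqP; split=> [x h a _|x h a]; first exact: h.
by have [/h//|/BJ ->] := boolP (a \in J).
Qed.

Context (P : probability T R) (Z : I -> T -> R).
Hypothesis mZ : forall a, measurable_fun setT (Z a).
Hypothesis indep :
  mutually_independent P (fun a => preimage_set_system setT (Z a) measurable).

Lemma prob_rectangle (J : seq I) (B : I -> set R) : uniq J ->
  (forall a, measurable (B a)) ->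
  P (\bigcap_(a in [set` J]) (Z a @^-1` B a)) =
    (\prod_(a <- J) P (Z a @^-1` B a))%E.
Proof.
by move=> uJ mB; apply: indep => // a _; exists (B a); rewrite ?setTI.
Qed.

(** By independence both laws give a cylinder the product of the probabilities of its sides; two
    probabilities that agree on a generating pi-system are equal. *)
Lemma involution_invariant_law (pi : I -> I) : involutive pi ->
  (forall a B, measurable B -> P (Z (pi a) @^-1` B) = P (Z a @^-1` B)) ->
  forall A, measurable A ->
  P (family (fun a => Z (pi a)) @^-1` A) = P (family Z @^-1` A).
Proof.
move=> piK Zpi A mA.
have mX := measurable_family mZ.
have mX' : measurable_fun setT (family (fun a => Z (pi a))).
  exact: measurable_family.
pose EX : {mfun T >-> noise I R} :=
  HB.pack (family Z) (isMeasurableFun.Build _ _ _ _ _ mX).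
pose EX' : {mfun T >-> noise I R} :=
  HB.pack (family (fun a => Z (pi a))) (isMeasurableFun.Build _ _ _ _ _ mX').
have HE : [set X | cylinder I R X /\ X `<=` setT] = cylinder I R.
  by apply/seteqP; split=> [X []|X] //.
have rectE (pi' : I -> I) (J : seq I) (B : I -> set R) :
    (forall a, a \notin J -> B a = setT) ->
    family (fun a => Z (pi' a)) @^-1` [set y | forall a, B a (y a)] =
    \bigcap_(a in [set` J]) (Z (pi' a) @^-1` B a).
  move=> BJ; apply/seteqP; split=> [x h a _|x h a]; first exact: h.
  by have [/h//|/BJ ->] := boolP (a \in J).
change (pushforward P EX' A = pushforward P EX A).
apply: (@g_sigma_algebra_measure_unique_trace _ R (noise I R) (cylinder I R)
  setT measurableT _ _ (pushforward P EX') (pushforward P EX)); rewrite ?HE //.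
- exact: sub_sigma_algebra.
- exact: cylinder_setI.
- move=> _ [J [B [uJ mB BJ ->]]]; transitivity
    (P (\bigcap_(a in [set` J]) (Z (pi a) @^-1` B a))).
    by rewrite -rectE.
  transitivity (P (\bigcap_(a in [set` J]) (Z a @^-1` B a))); last first.
    by rewrite -(rectE id).
  rewrite [RHS]prob_rectangle//.
  (* Since [pi] is its own inverse, permuting the variables amounts to permuting the sides of the
     rectangle. *)
  rewrite (_ : \bigcap_(a in _) _ =
      \bigcap_(a in [set` map pi J]) (Z a @^-1` B (pi a))).
    rewrite prob_rectangle ?map_inj_uniq//; last exact: inv_inj.
    by rewrite big_map; apply: eq_bigr => a _; rewrite piK Zpi.
  apply/seteqP; split=> x h a /=.
    by move=> /mapP[b bJ ->]; rewrite piK; exact: h.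
  by move=> aJ; have := h (pi a); rewrite /= piK; apply; exact: map_f.
- by change (P setT < +oo)%E; rewrite probability_setT ltry.
Qed.

End law_of_family.

(** * Measurability of the dynamics *)

Section borel_rows.
Context (R : realType) (n : nat).

Definition borel_row : measurableType (@open 'rV[R]_n).-sigma :=
  g_sigma_algebraType (@open 'rV[R]_n).

Lemma row_rat_approx (y : 'rV[R]_n) (m : nat) : exists q : 'rV[rat]_n,
  forall i, `|ratr (q 0 i) - y 0 i| < m.+1%:R^-1.
Proof.
have e0 : 0 < m.+1%:R^-1 :> R by rewrite invr_gt0.
have /choice[q qP] i : exists q : rat,
    `|ratr q - y 0 i| < m.+1%:R^-1.
  have /rat_in_itvoo[q] : y 0 i < y 0 i + m.+1%:R^-1 by rewrite ltrDl.
  rewrite in_itv /= => /andP[yq qy]; exists q.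
  by rewrite ger0_norm ?subr_ge0 1?ltW// ltrBlDl.
by exists (\row_i q i) => i; rewrite mxE.
Qed.

Definition rational_box (c : 'rV[rat]_n * nat) : set 'rV[R]_n :=
  [set y | forall i, `|ratr (c.1 0 i) - y 0 i| < c.2.+1%:R^-1].

(** There are countably many rational boxes. A box of half-width below [e / 2] that contains [y]
    lies in the ball of radius [e] around [y]. *)
Lemma open_bigcup_boxes (U : set 'rV[R]_n) : open U ->
  U = \bigcup_(c in [set c | rational_box c `<=` U]) rational_box c.
Proof.
move=> oU; apply/seteqP; split=> [y Uy|y [c cU]]; last exact: cU.
have [e e0 eU] : exists2 e : R, 0 < e & ball y e `<=` U.
  have : nbhs y U by exact: open_nbhs_nbhs.
  by move=> /nbhs_ballP[e /= e0 eU]; exists e.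
have [m me] : exists m : nat, m.+1%:R^-1 < e / 2.
  have e2 : 0 < e / 2 by rewrite divr_gt0.
  have [m _ h] := near_infty_natSinv_lt (PosNum e2).
  by exists m; exact: (h m (leqnn _)).
have [q qy] := row_rat_approx y m.
exists (q, m) => //= z /= zq; apply: eU; rewrite /ball /=; split=> // i j.
rewrite ord1 /ball /= (le_lt_trans (ler_distD (ratr (q 0 j)) _ _))//.
by rewrite (splitr e) ltrD//; apply: (lt_trans _ me); rewrite 1?distrC;
  [exact: qy|rewrite distrC; exact: zq].
Qed.

(** Measurability for the sigma-algebra of open sets reduces to the coordinates: an open set is a
    countable union of boxes, and a box is a finite conjunction of conditions on coordinates. *)
Lemma measurable_row d (T : measurableType d) (X : T -> borel_row) :
  (forall i, measurable_fun setT (fun x => (X x : 'rV[R]_n) 0 i)) ->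
  measurable_fun setT X.
Proof.
move=> mX.
apply: (@measurability d _ T borel_row setT X (@open 'rV[R]_n)) => //.
move=> _ [U oU <-]; rewrite setTI (open_bigcup_boxes oU) bigcup_mkcond.
rewrite preimage_bigcup; apply: countable_bigcupT_measurable => // c.
case: ifP => _; last by rewrite preimage_set0.
rewrite (_ : _ @^-1` _ = \bigcap_(i in [set: 'I_n])
    ((fun x => (X x : 'rV[R]_n) 0 i) @^-1`
       ball (ratr (c.1 0 i) : R) c.2.+1%:R^-1)).
  apply: fin_bigcap_measurable => // i _.
  rewrite -[X in measurable X]setTI; apply: mX => //.
  exact: measurable_ball.
by apply/seteqP; split=> [x h i _|x h i]; [exact: h|exact: h i I].
Qed.

Lemma continuous_measurable_row (f : 'rV[R]_n -> R) :
  continuous f -> @measurable_fun _ _ borel_row R setT f.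
Proof.
move=> cf.
apply: (@measurability _ _ borel_row R setT f _ (RGenOpens.measurableE R)).
move=> _ [_ [a [b ->]] <-]; rewrite setTI; apply: sub_sigma_algebra.
by apply: open_comp; [move=> y _; exact: cf|exact: itv_open].
Qed.

End borel_rows.

Section measurable_dynamics.
Context (R : realType) d (T : measurableType d) (n : nat).

(** The inverse, with value 0 at 0, is a real power on each half-line; it enters the displacement in
    a mutual conflict. *)
Lemma measurable_invr : measurable_fun setT (@GRing.inv R).
Proof.
rewrite (_ : GRing.inv =
    fun x => if 0 <= x then x `^ (-1) else - ((- x) `^ (-1))).
  apply: measurable_fun_ifT.
  - by apply: measurable_fun_ler => //; exact: measurable_cst.
  - exact: measurable_powR.
  - apply: measurableT_comp => //.
    apply: (measurableT_comp (measurable_powR _)); exact: oppr_measurable.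
apply/funext => x; case: ifPn => [x0|]; first by rewrite powR_inv1.
by rewrite -ltNge => x0; rewrite powR_inv1 ?oppr_ge0 1?ltW// invrN opprK.
Qed.

Lemma measurable_displacement (w : T -> 'I_n -> R) (D : T -> 'rV[R]_n) i :
  (forall j, measurable_fun setT (w ^~ j)) ->
  (forall j, measurable_fun setT (fun x => D x 0 j)) ->
  measurable_fun setT (fun x => displacement (w x) (D x) i).
Proof.
move=> mw mD; rewrite /displacement.
have mdiff j k : measurable_fun setT (fun x => w x j - w x k).
  exact: measurable_funB.
have mconf j k : measurable_fun setT
    (fun x => D x 0 k * w x i / (w x j - w x (ordS k))).
  apply: measurable_funM; first exact: measurable_funM.
  exact: (measurableT_comp measurable_invr).
apply: measurable_fun_ifT => //.
  by apply: measurable_fun_eqr => //; exact: measurable_cst.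
apply: measurable_fun_ifT; first by apply: measurable_fun_ltr.
  apply: measurable_fun_ifT; first by apply: measurable_fun_ler.
    exact: measurable_minr.
  by apply: measurable_fun_ifT => //; apply: measurable_fun_ler.
apply: measurable_fun_ifT; first by apply: measurable_fun_ler.
  by apply: measurable_maxr => //; exact: measurableT_comp.
apply: measurable_fun_ifT => //; first by apply: measurable_fun_ler.
by have := mconf (ord_pred i) (ord_pred i); rewrite ord_predK.
Qed.

Lemma measurable_run (w : T -> nat -> 'I_n -> R) (D : 'rV[R]_n) t i :
  (forall s j, measurable_fun setT (fun x => w x s j)) ->
  measurable_fun setT (fun x => run (w x) D t 0 i).
Proof.
move=> mw; elim: t i => [|t IHt] i /=; first exact: measurable_cst.
under eq_fun do rewrite mxE.
apply: measurable_funD; last exact: measurable_displacement.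
by apply: measurable_funB => //; exact: measurable_displacement.
Qed.

End measurable_dynamics.

(** * Independent trials *)

Section independent_trials.
Context d (T : measurableType d) (R : realType) (P : probability T R).

Lemma prob_no_success (G : nat -> set T) (g : R) :
  (forall m, measurable (G m)) ->
  (forall J : seq nat, uniq J ->
     P (\bigcap_(m in [set` J]) G m) = (g ^+ size J)%:E) ->
  forall M, P (\bigcap_(m in `I_M) ~` G m) = ((1 - g) ^+ M)%:E.
Proof.
move=> mG PG.
(* Complements are introduced one at a time. Carrying along a list [J] of later successes lets the
   failure at [M] be computed as a difference of two instances of the induction hypothesis. *)
suff key M (J : seq nat) : uniq J -> all (leq M) J ->
    P (\bigcap_(m in `I_M) ~` G m `&` \bigcap_(m in [set` J]) G m) =
    ((1 - g) ^+ M * g ^+ size J)%:E.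
  move=> M; have := key M [::] isT isT.
  by rewrite set_nil bigcap_set0 setIT expr0 mulr1.
elim: M J => [|M IHM] J uJ MJ.
  by rewrite II0 bigcap_set0 setTI expr0 mul1r PG.
set B := \bigcap_(m in [set` J]) G m.
have mB : measurable B by apply: fin_bigcap_measurable.
have mN : measurable (\bigcap_(m in `I_M) ~` G m).
  by apply: fin_bigcap_measurable => // m _; exact: measurableC.
have MJ' : all (leq M) J by apply: sub_all MJ => m; exact: ltnW.
have notinJ : M \notin J by apply/negP => /(allP MJ); rewrite ltnn.
set N := \bigcap_(m in `I_M) ~` G m.
pose B' := \bigcap_(m in [set` M :: J]) G m.
have mB' : measurable B' by apply: fin_bigcap_measurable.
have BB' : (N `&` B) `&` (N `&` B') = N `&` B'.
  apply/seteqP; split=> [x [_ //]|x [Nx h]]; split => //; split => // m mJ.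
  by apply: h; rewrite /= inE mJ orbT.
have PD : P ((N `&` B) `\` (N `&` B')) = (P (N `&` B) - P (N `&` B'))%E.
  rewrite measureD ?BB'//; [exact: measurableI|exact: measurableI|].
  by rewrite -ge0_fin_numE ?fin_num_measure//; exact: measurableI.
rewrite (_ : _ `&` B = (N `&` B) `\` (N `&` B')).
  rewrite PD IHM// IHM/= ?notinJ ?leqnn// -EFinB; congr EFin.
  by rewrite exprSr exprS; ring.
apply/seteqP; split=> [x [Nx Bx]|x [[Nx Bx] h]]; split.
- by split=> // m mM; apply: Nx; exact: ltnW.
- move=> [_ /(_ M)]; rewrite /= inE eqxx => /(_ isT).
  by apply: Nx => /=.
- move=> m /=; rewrite ltnS leq_eqVlt => /predU1P[->|]; last exact: Nx.
  move=> GM; apply: h; split=> // k /=; rewrite inE => /predU1P[->//|].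
  exact: Bx.
- by [].
Qed.

End independent_trials.

(** * Time reversal up to a finite horizon *)

Section reversal.
Variable A : Type.

(** Times from [t] on stay in place, so this is an involution of the whole index set and leaves the
    joint law of the noise invariant. *)
Definition reversal (t : nat) (a : nat * A) : nat * A :=
  (if (a.1 < t)%N then (t - a.1.+1)%N else a.1, a.2).

Lemma reversalK t : involutive (reversal t).
Proof.
move=> [s j]; rewrite /reversal /=; congr pair.
by case: (ltnP s t) => st; last rewrite ltnNge st //=; rewrite ifT; lia.
Qed.

End reversal.

(** * Limits in law along residue classes *)

Section cesaro_periodic.
Context (R : realType).

Lemma series_periodic (c : nat -> R) (K : nat) :
  (forall t, c (t + K)%N = c t) ->
  \sum_(0 <= k < K) c k = 0 -> forall N, series c (N + K) = series c N.
Proof.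
move=> cK c0 N; rewrite !seriesEnat /=.
rewrite (@big_cat_nat _ _ _ K) /= ?leq_addl// c0 add0r.
by rewrite -{1}[K]add0n big_addn addnK; apply: eq_bigr => t _; rewrite cK.
Qed.

(** Up to a sequence that converges to the claimed limit, [a] is the centred periodic sequence [c],
    whose partial sums are bounded and whose means therefore vanish. *)
Lemma cesaro_asymptotically_periodic (a b : nat -> R) (K : nat) : (0 < K)%N ->
  (fun t => a t - b (t %% K)%N) @ \oo --> (0 : R) ->
  arithmetic_mean a @ \oo --> K%:R^-1 * \sum_(k < K) b k.
Proof.
move=> K0 ab; set S := K%:R^-1 * _.
pose c t := b (t %% K)%N - S.
have cK t : c (t + K)%N = c t by rewrite /c modnDr.
have c0 : \sum_(0 <= k < K) c k = 0.
  rewrite big_mkord sumrB sumr_const card_ord -mulr_natl /S.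
  rewrite mulVKf ?pnatr_eq0 -?lt0n//.
  by under eq_bigr do rewrite modn_small//; rewrite subrr.
pose C : R := \sum_(k < K) `|series c k|.
have cC N : `|series c N| <= C.
  have -> : series c N = series c (N %% K)%N.
    rewrite {1}(divn_eq N K) addnC; elim: (N %/ K)%N => [|q IHq].
      by rewrite mul0n addn0.
    by rewrite mulSnr addnA series_periodic.
  rewrite /C (bigD1 (Ordinal (ltn_pmod N K0)))//= lerDl.
  by apply: sumr_ge0.
have mean_c : arithmetic_mean c @ \oo --> (0 : R).
  have hC : (fun N => C * harmonic N) @ \oo --> (0 : R).
    by rewrite -(mulr0 C); apply: cvgMr; exact: cvg_harmonic.
  apply: (@squeeze_cvgr _ _ _ _ (fun N => - (C * harmonic N))
    (fun N => C * harmonic N)) => //.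
    apply: nearW => N; rewrite -ler_norml /arithmetic_mean /= normrM mulrC.
    have -> : `|N.+1%:R^-1| = harmonic N :> R by rewrite gtr0_norm ?invr_gt0.
    by apply: ler_wpM2r; [exact: harmonic_ge0|exact: cC].
  by rewrite -oppr0; exact: cvgN.
have mean_ab : arithmetic_mean (fun t => a t - b (t %% K)%N + S) @ \oo --> S.
  apply: cesaro; rewrite -[X in _ --> X]add0r.
  by apply: cvgD => //; exact: cvg_cst.
rewrite (_ : arithmetic_mean a = fun N =>
  arithmetic_mean (fun t => a t - b (t %% K)%N + S) N + arithmetic_mean c N).
  by rewrite -[X in _ --> X]addr0; exact: cvgD.
apply/funext => N; rewrite /arithmetic_mean /= -mulrDr; congr *%R.
by rewrite !seriesEnat /= -big_split/=; apply: eq_bigr => t _; rewrite /c; ring.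
Qed.

End cesaro_periodic.

(** * From eventual coupling to a Cesaro limit *)

Section eventual_coupling.
Context d (T : measurableType d) (R : realType) (P : probability T R) (n : nat).
Variables (S : set 'rV[R]_n) (Y : nat -> 'rV[R]_n -> T -> 'rV[R]_n).
Variables (F : nat -> set T) (K : nat) (D0 : 'rV[R]_n).
Hypotheses (K_gt0 : (0 < K)%N) (SD0 : S D0).
Hypothesis mY : forall t D i, measurable_fun setT (fun x => Y t D x 0 i).
Hypothesis mF : forall t, measurable (F t).
Hypothesis cvgF : (fun t => fine (P (~` F t))) @ \oo --> (0 : R).
Hypothesis coupled : forall t j x D D', F t x -> S D -> S D' ->
  Y (t + j * K)%N D x = Y t D' x.

(** The upper limit always exists and is measurable; once a coupling event has occurred, the
    sequence is constant and this is its final value. *)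
Definition limit_state (rho : nat) (x : T) : borel_row R n :=
  \row_i fine (limn_esup (fun m => (Y (rho + m * K)%N D0 x 0 i)%:E)).

Lemma limit_stateE rho m x D : F (rho + m * K)%N x -> S D ->
  limit_state rho x = Y (rho + m * K)%N D x.
Proof.
move=> Fx SD; apply/rowP => i; rewrite mxE.
have cvgY : (fun k => (Y (rho + k * K)%N D0 x 0 i)%:E) @ \oo -->
    (Y (rho + m * K)%N D x 0 i)%:E.
  apply: cvg_near_cst; exists m => // k /= mk.
  by rewrite -(subnK mk) mulnDl addnCA addnC (coupled _ Fx SD0 SD).
by rewrite limn_esup_lim (cvg_lim _ (cvg_esups cvgY)).
Qed.

Lemma measurable_limit_state rho : measurable_fun setT (limit_state rho).
Proof.
apply: measurable_row => i.
under eq_fun do rewrite mxE.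
apply: measurableT_comp => //; apply: measurable_fun_limn_esup => m.
by apply/measurable_EFinP; exact: mY.
Qed.

(** Coupling inequality: the two states agree on [F t], and elsewhere the values of [f] differ by at
    most [2 * M]. *)
Lemma mean_limit_state (f : 'rV[R]_n -> R) (M : R) t D : continuous f ->
  (forall y, `|f y| <= M) -> S D ->
  `|\int[P]_x f (Y t D x) - \int[P]_x f (limit_state (t %% K) x)| <=
  2 * M * fine (P (~` F t)).
Proof.
move=> cf fM SD; have mf := continuous_measurable_row cf.
have M0 : 0 <= M := le_trans (normr_ge0 _) (fM 0).
have mfY : measurable_fun setT (fun x => f (Y t D x)).
  apply: (measurableT_comp mf).
  by apply: (@measurable_row R n _ T (fun x => Y t D x : borel_row R n)).
have mfX : measurable_fun setT (fun x => f (limit_state (t %% K) x)).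
  by apply: (measurableT_comp mf); exact: measurable_limit_state.
have iY := probability_bounded_integrable P mfY (fun x => fM _).
have iX := probability_bounded_integrable P mfX (fun x => fM _).
have fB x : `|f (Y t D x) - f (limit_state (t %% K) x)| <= 2 * M.
  by rewrite (le_trans (ler_normB _ _))// mulr_natl mulr2n lerD.
have mB := measurable_funB mfY mfX.
have iB := probability_bounded_integrable P mB fB.
rewrite -RintegralB// (le_trans (le_normr_Rintegral _ iB))//.
have mFc : measurable (~` F t) by exact: measurableC.
have m1 : measurable_fun setT (fun x => 2 * M * \1_(~` F t) x : R).
  by apply: measurable_funM => //; exact: measurable_indic.
apply: (@le_trans _ _ (\int[P]_x (2 * M * \1_(~` F t) x))).
  apply: le_Rintegral => //.
  - exact: integrable_norm.
  - apply: (@probability_bounded_integrable _ _ _ P _ (2 * M)) => // x.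
    rewrite normrM (ger0_norm (mulr_ge0 _ M0))// ler_piMr ?mulr_ge0//.
    by rewrite indicE; case: (_ \in _); rewrite ?normr1 ?normr0.
  - move=> x _ /=; have [Fx|Fx] := pselect (F t x).
      have := @limit_stateE (t %% K) (t %/ K) x D.
      rewrite addnC -divn_eq => -> //; rewrite subrr normr0.
      by rewrite !mulr_ge0// indicE.
    by rewrite indicE mem_set// mulr1.
rewrite RintegralZl//; last first.
  apply: (@probability_bounded_integrable _ _ _ P _ 1) => [|x].
    exact: measurable_indic.
  by rewrite indicE; case: (_ \in _); rewrite ?normr1 ?normr0.
by rewrite /Rintegral integral_indic// setIT.
Qed.

Lemma cesaro_limit : exists mu : probability (borel_row R n) R,
  forall D, S D -> forall f : 'rV[R]_n -> R, continuous f -> bounded_fun f ->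
  arithmetic_mean (fun t => \int[P]_x f (Y t D x)) @ \oo --> \int[mu]_y f y.
Proof.
pose X rho : {mfun T >-> borel_row R n} := HB.pack (limit_state rho)
  (isMeasurableFun.Build _ _ _ _ _ (measurable_limit_state rho)).
have Kinv : 0 <= K%:R^-1 :> R by rewrite invr_ge0.
(* The limit is the average of the laws of the [K] limit states, one per residue class. *)
pose nu := mscale (NngNum Kinv) (msum (fun rho => distribution P (X rho)) K).
have nu1 : nu setT = 1%E.
  rewrite /nu /mscale/= /msum (eq_bigr (fun=> 1%:E)) => [|rho _]; last first.
    exact: probability_setT.
  rewrite sumEFin sumr_const card_ord -EFinM mulVf//.
  by rewrite pnatr_eq0 -lt0n.
pose mu : probability (borel_row R n) R :=
  HB.pack nu (Measure_isProbability.Build _ _ _ nu nu1).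
exists mu => D SD f cf [M0 [_ fM0]].
have [M fM] : exists M : R, forall y, `|f y| <= M.
  by exists (`|M0| + 1) => y; apply: fM0 => //; rewrite ltr_pwDr// ler_norm.
have mf := continuous_measurable_row cf.
have -> : \int[mu]_y f y =
    K%:R^-1 * \sum_(k < K) \int[P]_x f (limit_state k x).
  (* Adding [M] makes the integrand nonnegative, so that the integral splits over the scaled sum of
     measures; the constant cancels at the end. *)
  have mfM : measurable_fun setT (fun y : borel_row R n => (f y + M)%:E).
    by apply/measurable_EFinP; apply: measurable_funD => //.
  have fM0' y : (0 <= (f y + M)%:E)%E.
    by rewrite lee_fin; move: (fM y); rewrite ler_norml => /andP[]; lra.
  have shift d' (U : measurableType d') (p : probability U R) (h : U -> R) :
      measurable_fun setT h -> (forall u, `|h u| <= M) ->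
      (\int[p]_u (h u + M)%:E = (\int[p]_u h u + M)%:E)%E.
    move=> mh hM.
    have ih := probability_bounded_integrable p mh hM.
    have iM : p.-integrable setT (EFin \o cst M).
      by apply: (@probability_bounded_integrable _ _ _ _ _ `|M|).
    under eq_integral do rewrite EFinD.
    rewrite integralD// integral_cst//.
    rewrite [X in (_ * X)%E](@probability_setT _ _ _ p) mule1 EFinD.
    by congr (_ + _)%E; rewrite /Rintegral fineK//; exact: integrable_fin_num.
  have := shift _ _ mu f mf fM.
  have -> : (\int[mu]_u (f u + M)%:E)%E =
      ((K%:R^-1)%:E * \sum_(k < K) \int[distribution P (X k)]_u (f u + M)%:E)%E.
    by rewrite ge0_integral_mscale// ge0_integral_measure_sum.
  have mfX k : measurable_fun setT (fun x => f (limit_state k x)).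
    by apply: (measurableT_comp mf); exact: measurable_limit_state.
  have dist k : (\int[distribution P (X k)]_u (f u + M)%:E =
      (\int[P]_x f (limit_state k x) + M)%:E)%E.
    rewrite -(shift _ _ P (fun x => f (limit_state k x)))//.
    rewrite integral_distribution//.
    apply: (@probability_bounded_integrable _ _ _ P
      (fun x => f (limit_state k x) + M) (M + `|M|)).
      by apply: measurable_funD => //.
    by move=> x; rewrite (le_trans (ler_normD _ _))// lerD2r.
  rewrite (eq_bigr _ (fun (k : 'I_K) _ => dist k)) sumEFin -EFinM => -[].
  rewrite big_split/= sumr_const card_ord mulrDr -[X in _ + _ * X]mulr_natl.
  by rewrite mulKf ?pnatr_eq0 -?lt0n// => /addIr.
apply: (@cesaro_asymptotically_periodic R _
  (fun k => \int[P]_x f (limit_state k x))) => //.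
apply: norm_cvg0.
apply: (@squeeze_cvgr _ _ _ _ (cst 0) (fun t => 2 * M * fine (P (~` F t)))).
- by apply: nearW => t; rewrite normr_ge0/= mean_limit_state.
- exact: cvg_cst.
- by rewrite -(mulr0 (2 * M)); exact: cvgMr.
Qed.

End eventual_coupling.

(** * Backward coalescence *)

Section blocks.
Context d (T : measurableType d) (R : realType) (P : probability T R).
Context (A : finType) (Z : nat * A -> T -> R).
Hypothesis mZ : forall a, measurable_fun setT (Z a).
Hypothesis indep :
  mutually_independent P (fun a => preimage_set_system setT (Z a) measurable).
Hypothesis iid : forall s t j B, measurable B ->
  P (Z (s, j) @^-1` B) = P (Z (t, j) @^-1` B).
Variables (K : nat) (H : nat -> A -> set R).
Hypothesis K_gt0 : (0 < K)%N.
Hypothesis mH : forall s j, measurable (H s j).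
Hypothesis H_periodic : forall s j, H (s %% K)%N j = H s j.
Hypothesis H_gt0 : forall s j, (0 < P (Z (s, j) @^-1` H s j))%E.

Definition good_block (m : nat) : set (noise (nat * A)%type R) :=
  [set y | forall s j, (s < K)%N -> H s j ((y : _ -> R) (m * K + s, j)%N)].

Lemma measurable_good_block m : measurable (good_block m).
Proof.
rewrite (_ : good_block m = \bigcap_(s in `I_K) \bigcap_(j in [set: A])
    ((fun y : noise (nat * A)%type R => (y : _ -> R) (m * K + s, j)%N)
       @^-1` H s j)).
  apply: fin_bigcap_measurable => // s _.
  apply: fin_bigcap_measurable => // j _.
  by rewrite -[X in measurable X]setTI; apply: measurable_coordinate.
by apply/seteqP; split=> [y h s sK j _|y h s j sK]; exact: h.
Qed.

Let g : R := \prod_(a : 'I_K * A) fine (P (Z (a.1 : nat, a.2) @^-1` H a.1 a.2)).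

Let mfam : measurable_fun setT (family Z). Proof. exact: measurable_family. Qed.

(** Different blocks use disjoint sets of indices, so one product formula over all of them applies;
    stationarity of the noise and periodicity of [H] give every block the same factor [g]. *)
Lemma prob_good_blocks (J : seq nat) : uniq J ->
  P (\bigcap_(m in [set` J]) (family Z @^-1` good_block m)) =
    (g ^+ size J)%:E.
Proof.
move=> uJ.
pose idx (m : nat) (a : 'I_K * A) := ((m * K + a.1)%N, a.2).
pose L := [seq idx m a | m <- J, a <- enum {: 'I_K * A}].
have uL : uniq L.
  apply: allpairs_uniq => //; first exact: enum_uniq.
  move=> [m [s j]] [m' [s' j']] _ _ [] /= e ->.
  (* Division by [K] recovers the number of the block from a time in it. *)
  have ms : m = m'.
    have := congr1 (divn^~ K) e.
    by rewrite !divnMDl// !divn_small// !addn0.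
  by move: e; rewrite ms => /addnI /ord_inj ->.
rewrite (_ : \bigcap_(m in [set` J]) _ =
    \bigcap_(a in [set` L]) (Z a @^-1` H a.1 a.2)).
  rewrite (prob_rectangle indep (B := fun a => H a.1 a.2))//.
  rewrite /L big_allpairs_dep /=.
  have block m : (\prod_(a <- enum {: 'I_K * A})
      P (Z (idx m a) @^-1` H (idx m a).1 (idx m a).2) = g%:E)%E.
    rewrite big_enum /= /g -prodEFin; apply: eq_bigr => -[s j] _ /=.
    rewrite -(H_periodic (m * K + s)) modnMDl modn_small//.
    rewrite (iid _ s)// fineK// fin_num_measure//.
    by rewrite -[X in measurable X]setTI; exact: mZ.
  rewrite (eq_bigr _ (fun m _ => block m)) prodEFin; congr EFin.
  by rewrite big_const_seq count_predT iter_mulr_1.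
apply/seteqP; split=> x h.
  move=> _ /allpairsP[[m [s j]] [/= mJ _ ->]] /=.
  have := h m mJ s j (ltn_ord s).
  by rewrite -(H_periodic (m * K + s)) modnMDl modn_small.
move=> m mJ s j sK /=.
have := h (idx m (Ordinal sK, j)); rewrite /= -(H_periodic (m * K + s)).
rewrite modnMDl modn_small//; apply; apply/allpairsP.
by exists (m, (Ordinal sK, j)); rewrite mem_enum.
Qed.

Lemma good_block_prob_gt0 : 0 < g.
Proof.
rewrite /g; apply: prodr_gt0 => -[s j] _ /=.
by rewrite fine_gt0// H_gt0/= -ge0_fin_numE ?fin_num_measure//;
  rewrite -[X in measurable X]setTI; exact: mZ.
Qed.

Lemma measurable_no_good_block M :
  measurable (\bigcap_(m in `I_M) ~` good_block m).
Proof.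
by apply: fin_bigcap_measurable => // m _; apply: measurableC;
  exact: measurable_good_block.
Qed.

Lemma reversal_law t (B : set (noise (nat * A)%type R)) : measurable B ->
  P (family (fun a => Z (reversal t a)) @^-1` B) = P (family Z @^-1` B).
Proof.
apply: involution_invariant_law => //; first exact: reversalK.
by move=> [s j] C mC; exact: iid.
Qed.

Lemma prob_no_good_block M :
  P (family Z @^-1` \bigcap_(m in `I_M) ~` good_block m) = ((1 - g) ^+ M)%:E.
Proof.
rewrite preimage_bigcap.
apply: (@prob_no_success _ _ _ P (fun m => family Z @^-1` good_block m)).
  move=> m; rewrite -[X in measurable X]setTI; apply: mfam => //.
  exact: measurable_good_block.
exact: prob_good_blocks.
Qed.

Lemma cvg_no_good_block :
  (fun M => fine (P (family Z @^-1` \bigcap_(m in `I_M) ~` good_block m)))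
    @ \oo --> (0 : R).
Proof.
under eq_fun do rewrite prob_no_good_block /=.
apply: cvg_expr; have g0 := good_block_prob_gt0.
(* The case of a single block shows that [1 - g] is a probability, hence nonnegative; with [0 < g]
   its powers tend to 0. *)
have : ((1 - g) ^+ 1)%:E =
    P (family Z @^-1` \bigcap_(m in `I_1) ~` good_block m).
  by rewrite prob_no_good_block.
rewrite expr1 => g1; have : (0 <= (1 - g)%:E)%E by rewrite g1.
by rewrite lee_fin => h; rewrite ger0_norm//; lra.
Qed.

Variables (n : nat) (r : 'I_n -> R).
(** [drive s] turns the noise of time [s] into effective velocities; this treats all updating rules
    at once. *)
Variable drive : nat -> (A -> R) -> 'I_n -> R.
Hypothesis drive_periodic : forall s, drive (s %% K)%N = drive s.
Hypothesis drive_measurable : forall s i, measurable_fun setT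
  (fun y : noise (nat * A)%type R => drive s (fun j => (y : _ -> R) (s, j)) i).
Hypothesis drive_sync : forall xi : nat -> A -> R,
  (forall s j, H s j (xi s j)) ->
  forall D D', admissible r D -> admissible r D' ->
  run (fun s => drive s (xi s)) D K = run (fun s => drive s (xi s)) D' K.

Let W (y : noise (nat * A)%type R) (s : nat) : 'I_n -> R :=
  drive s (fun j => (y : _ -> R) (s, j)).

(** For each fixed [t] this has the law of the original noise, but the states it produces settle
    path by path along a residue class, which those of the forward process need not do. *)
Let backward (t : nat) : T -> noise (nat * A)%type R :=
  family (fun a => Z (reversal t a)).

Let F (t : nat) : set T :=
  backward t @^-1` (~` \bigcap_(m in `I_(t %/ K)) ~` good_block m).

Let mbackward t : measurable_fun setT (backward t).
Proof. by apply: measurable_family => a; exact: mZ. Qed.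

Let mF t : measurable (F t).
Proof.
rewrite /F -[X in measurable X]setTI; apply: mbackward => //.
by apply: measurableC; exact: measurable_no_good_block.
Qed.

Let cvgF : (fun t => fine (P (~` F t))) @ \oo --> (0 : R).
Proof.
have FE t : P (~` F t) =
    P (family Z @^-1` \bigcap_(m in `I_(t %/ K)) ~` good_block m).
  rewrite -(reversal_law t); last exact: measurable_no_good_block.
  by congr (P _); rewrite /F preimage_setC setCK.
under eq_fun do rewrite FE.
apply: (cvg_comp (fun t => t %/ K)%N
  (fun M => fine (P (family Z @^-1` \bigcap_(m in `I_M) ~` good_block m)))).
  apply/cvgnyPge => M; exists (M * K)%N => // t /=.
  by rewrite leq_divRL.
exact: cvg_no_good_block.
Qed.

(** The good block merges the two states in which it starts, and all later steps are common. *)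
Lemma good_block_coalescence y m t D D' : (m < t %/ K)%N -> good_block m y ->
  admissible r D -> admissible r D' -> run (W y) D t = run (W y) D' t.
Proof.
move=> mt gy aD aD'.
have -> : t = (m * K + (K + (t - m.+1 * K)))%N.
  have : (m.+1 * K <= t)%N.
    by rewrite (leq_trans _ (leq_trunc_div t K))// leq_mul2r mt orbT.
  rewrite mulSn; lia.
rewrite !(run_add (W y) _ (m * K)) !run_add; congr run.
(* [drive_sync] asks for good noise at all times; the block is repeated periodically, and only its
   first copy is read. *)
pose xi s j := (y : _ -> R) (m * K + s %% K, j)%N.
have xiE s : (s < K)%N -> W y (m * K + s)%N = drive s (xi s).
  move=> sK; rewrite /W -drive_periodic modnMDl drive_periodic.
  by rewrite /xi modn_small.
rewrite !(eq_run _ xiE); apply: drive_sync; try exact: run_admissible.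
move=> s j; rewrite /xi -H_periodic; apply: gy; exact: ltn_pmod.
Qed.

(** The longer run starts with [j * K] extra steps and then repeats the shorter one. The extra steps
    only change the admissible starting state, which the good block forgets. *)
Let coupled t j x D D' : F t x -> admissible r D -> admissible r D' ->
  run (W (backward (t + j * K) x)) D (t + j * K) = run (W (backward t x)) D' t.
Proof.
move=> Fx aD aD'; rewrite addnC run_add.
rewrite (@eq_run _ _ _ (W (backward t x))); last first.
  (* With horizon [t + j * K], step [j * K + s] reads the noise of time [t - s.+1], as step [s] does
     with horizon [t]; [drive] agrees because the shift is a multiple of [K]. *)
  move=> s st; rewrite /W -drive_periodic modnMDl drive_periodic; congr drive.
  apply/funext => a; rewrite /backward /family /reversal /= ltn_add2l st.
  by congr (Z (_, a) x); lia.
have [m mt gm] : exists2 m, (m < t %/ K)%N & good_block m (backward t x).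
  apply: contrapT => no; apply: Fx => m /= mt gm; apply: no.
  by exists m.
by apply: good_block_coalescence gm _ _ => //; exact: run_admissible.
Qed.

(** Forward and backward states have the same law at each time, so the means of [f] coincide and
    [cesaro_limit] applies to the backward ones. *)
Lemma driven_process_ergodic : exists mu : probability (borel_row R n) R,
  forall D, admissible r D ->
  forall f : 'rV[R]_n -> R, continuous f -> bounded_fun f ->
  arithmetic_mean (fun t =>
    \int[P]_x f (run (fun s => drive s (fun j => Z (s, j) x)) D t)) @ \oo
  --> \int[mu]_y f y.
Proof.
have [[D0 aD0]|noD] := pselect (exists D0, admissible r D0); last first.
  (* Without admissible gaps any probability will do. *)
  exists (dirac (0 : borel_row R n)) => D aD.
  by exfalso; apply: noD; exists D.
have mrun t D i : measurable_fun setT (fun y => run (W y) D t 0 i).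
  by apply: measurable_run => s j; exact: drive_measurable.
have [mu muP] := @cesaro_limit _ T R P n (admissible r)
  (fun t D x => run (W (backward t x)) D t) F K D0 K_gt0 aD0
  (fun t D i => measurableT_comp (mrun t D i) (mbackward t)) mF cvgF coupled.
exists mu => D aD f cf bf; have [M0 [_ fM0]] := bf.
rewrite (_ : (fun t => _) =
    (fun t => \int[P]_x f (run (W (backward t x)) D t))); first exact: muP.
apply/funext => t; apply/esym.
apply: (@eq_law_Rintegral _ _ _ _ _ P (backward t) (family Z)
  (fun y => f (run (W y) D t)) (`|M0| + 1)) => //.
- by move=> B; exact: reversal_law.
- apply: (measurableT_comp (continuous_measurable_row cf)).
  exact: (@measurable_row R n _ _ (fun y => run (W y) D t : borel_row R n)).
- by move=> y; apply: fM0 => //; rewrite ltr_pwDr// ler_norm.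
Qed.

End blocks.

(** * Updating rules *)

Section synchronizing_velocities.
Context (R : realType).

(** Otherwise monotonicity makes every [S m] null, and then so is their countable union. *)
Lemma nondecreasing_eventually_gt0 (p : probability R R) (S : nat -> set R) :
  (forall m, measurable (S m)) -> nondecreasing_seq S ->
  (0 < p (\bigcup_m S m))%E -> \forall m \near \oo, (0 < p (S m))%E.
Proof.
move=> mS ndS pS; apply: contrapT => nonear.
have S0 m : p (S m) = 0%E.
  apply/le_anti; rewrite measure_ge0 andbT leNgt; apply/negP => Sm.
  apply: nonear; exists m => // k /= mk; apply: (lt_le_trans Sm).
  by apply: le_measure; rewrite ?inE//; apply/subsetPset/ndS.
have neg : p.-negligible (\bigcup_m S m).
  apply: negligible_bigcup => m; exists (S m).
  by split; [exact: mS|exact: S0|].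
move: pS; rewrite (_ : p _ = 0%E) ?ltxx//.
by apply: measure_negligible => //; exact: bigcupT_measurable.
Qed.

Lemma natSinv_le (m k : nat) : (m <= k)%N -> k.+1%:R^-1 <= m.+1%:R^-1 :> R.
Proof. by move=> mk; rewrite lef_pV2 ?posrE// ler_nat. Qed.

Lemma natSinv_lt (z : R) : 0 < z -> exists m : nat, m.+1%:R^-1 < z.
Proof.
move=> z0; have [m _ h] := near_infty_natSinv_lt (PosNum z0).
by exists m; exact: (h m (leqnn _)).
Qed.

Lemma measurable_ray_lt (a : R) : measurable [set z : R | z < a].
Proof. by rewrite -set_itvNyo; exact: measurable_itv. Qed.

Lemma measurable_ray_le (a : R) : measurable [set z : R | z <= a].
Proof. by rewrite -set_itvNyc; exact: measurable_itv. Qed.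

Lemma measurable_ray_gt (a : R) : measurable [set z : R | a < z].
Proof. by rewrite -set_itvoy; exact: measurable_itv. Qed.

Lemma measurable_ray_ge (a : R) : measurable [set z : R | a <= z].
Proof. by rewrite -set_itvcy; exact: measurable_itv. Qed.

(** Turns strict positivity into a margin. It holds for all large [m], so finitely many particles
    can share one margin. *)
Lemma near_positive_velocity (p : probability R R) :
  (0 < p [set z : R | (0 < z)%R])%E ->
  \forall m \near \oo, (0 < p [set z : R | (m.+1%:R^-1 < z)%R])%E.
Proof.
move=> p0; apply: nondecreasing_eventually_gt0.
- by move=> m; exact: measurable_ray_gt.
- move=> m k mk; apply/subsetPset => z /=.
  exact: le_lt_trans (natSinv_le mk).
- rewrite (_ : \bigcup_m _ = [set z | 0 < z])//.
  apply/seteqP; split=> [z [m _]|z].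
    by apply: lt_trans; rewrite invr_gt0.
  by move=> /natSinv_lt[m mz]; exists m.
Qed.

Lemma near_negative_velocity (p : probability R R) :
  (0 < p [set z : R | (z < 0)%R])%E ->
  \forall m \near \oo, (0 < p [set z : R | (z < - m.+1%:R^-1)%R])%E.
Proof.
move=> p0; apply: nondecreasing_eventually_gt0.
- by move=> m; exact: measurable_ray_lt.
- move=> m k mk; apply/subsetPset => z /= /lt_le_trans; apply.
  by rewrite lerN2 natSinv_le.
- rewrite (_ : \bigcup_m _ = [set z | z < 0])//.
  apply/seteqP; split=> [z [m _]|z].
    by move=> /= /lt_trans; apply; rewrite oppr_lt0 invr_gt0.
  rewrite /= -oppr_gt0 => /natSinv_lt[m mz]; exists m => //=.
  by rewrite ltrNr.
Qed.

(** The task is to find a particle [b] that can be nonpositive while all the others can be positive,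
    or the mirror image. *)
Lemma exists_synchronizing (n : nat) (r : 'I_n -> R)
    (law : 'I_n -> probability R R) : (forall i, 0 <= r i) ->
  both_signs law ->
  (forall i j, i != j -> (0 < law i [set z | (0 < z)%R])%E \/
                         (0 < law j [set z | (z < 0)%R])%E) ->
  exists (H : 'I_n -> set R) (M : nat), [/\ (0 < M)%N,
    forall i, measurable (H i), forall i, (0 < law i (H i))%E &
    synchronizing r H (n * M * n)].
Proof.
move=> r0 [[p pP] [q qP]] cmp.
(* The margin [m.+1%:R^-1] is paired with [M = m.+1] rounds, which drain a gap of length at most
   1. *)
have MV m : 1 <= m.+1%:R^-1 * m.+1%:R :> R by rewrite mulVf.
have m0 m : 0 < m.+1%:R^-1 :> R by rewrite invr_gt0.
have right b : (0 < law b [set z | (z <= 0)%R])%E ->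
    (forall j, j != b -> (0 < law j [set z | (0 < z)%R])%E) ->
    exists (H : 'I_n -> set R) (M : nat), [/\ (0 < M)%N,
      forall i, measurable (H i), forall i, (0 < law i (H i))%E &
      synchronizing r H (n * M * n)].
  move=> bP jP.
  have [m _ /(_ m (leqnn _)) mP] : \forall m \near \oo,
      forall i, (0 < law i (toward_right_of b m.+1%:R^-1 i))%E.
    apply: filter_forall => i; rewrite /toward_right_of.
    by case: eqVneq => [->|/jP]; [exact: nearW|exact: near_positive_velocity].
  exists (toward_right_of b m.+1%:R^-1), m.+1; split => //.
  - move=> i; rewrite /toward_right_of; case: eqP => _.
      exact: measurable_ray_le.
    exact: measurable_ray_gt.
  - exact: synchronizing_right (MV m).
have left b : (0 < law b [set z | (0 <= z)%R])%E ->
    (forall j, j != b -> (0 < law j [set z | (z < 0)%R])%E) ->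
    exists (H : 'I_n -> set R) (M : nat), [/\ (0 < M)%N,
      forall i, measurable (H i), forall i, (0 < law i (H i))%E &
      synchronizing r H (n * M * n)].
  move=> bP jP.
  have [m _ /(_ m (leqnn _)) mP] : \forall m \near \oo,
      forall i, (0 < law i (toward_left_of b m.+1%:R^-1 i))%E.
    apply: filter_forall => i; rewrite /toward_left_of.
    by case: eqVneq => [->|/jP]; [exact: nearW|exact: near_negative_velocity].
  exists (toward_left_of b m.+1%:R^-1), m.+1; split => //.
  - move=> i; rewrite /toward_left_of; case: eqP => _.
      exact: measurable_ray_ge.
    exact: measurable_ray_lt.
  - exact: synchronizing_left (MV m).
have [allpos|] := pselect (forall i, (0 < law i [set z | (0 < z)%R])%E).
  apply: (right q) => [|j _]; last exact: allpos.
  apply: (lt_le_trans qP); apply: le_measure; rewrite ?inE.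
  - exact: measurable_ray_lt.
  - exact: measurable_ray_le.
  - by move=> z /= /ltW.
(* Some [i] is almost surely nonpositive, so by comparison all the others can be negative. If [i]
   can be nonnegative, it serves as [b]. *)
move=> /existsNP[i iP].
have neg j : j != i -> (0 < law j [set z | (z < 0)%R])%E.
  by rewrite eq_sym => /cmp[].
have [i0|i0] := pselect (is_true (0 < law i [set z | (0 <= z)%R])%E).
  exact: left i0 neg.
apply: (left p) => [|j _].
  apply: (lt_le_trans pP); apply: le_measure; rewrite ?inE.
  - exact: measurable_ray_gt.
  - exact: measurable_ray_ge.
  - by move=> z /= /ltW.
(* In the remaining case [i] is almost surely negative, so every particle can be negative, and [b]
   is the particle [p] that can be positive. *)
have [->|/neg//] := eqVneq j i.
apply: contra_notT i0 => ni.
rewrite (_ : [set z | 0 <= z] = ~` [set z | z < 0]).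
  rewrite probability_setC; last exact: measurable_ray_lt.
  rewrite (_ : law i _ = 0%E) ?sube0 ?lte01//.
  by apply/le_anti; rewrite measure_ge0 andbT leNgt.
by apply/seteqP; split=> z /=; rewrite leNgt => /negP.
Qed.

End synchronizing_velocities.

Lemma mutually_independent_reindex (R : realType) d (T : measurableType d)
    (P : probability T R) (I J : choiceType) (F : I -> set (set T))
    (G : J -> set (set T)) (h : J -> I) (h' : I -> J) :
  cancel h h' -> (forall b, G b `<=` F (h b)) ->
  mutually_independent P F -> mutually_independent P G.
Proof.
move=> hK GF iF L E uL GE.
have -> : \bigcap_(b in [set` L]) E b = \bigcap_(a in [set` map h L]) E (h' a).
  apply/seteqP; split=> x Ex.
    by move=> _ /mapP[b bL ->]; rewrite hK; exact: Ex.
  by move=> b bL; rewrite -(hK b); apply: Ex; exact: map_f.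
rewrite iF ?(map_inj_uniq (can_inj hK))// => [|_ /mapP[b bL ->]].
  by rewrite big_map; apply: eq_bigr => b _; rewrite hK.
by rewrite hK; apply/GF/GE.
Qed.

Section updating_rules.
Context (R : realType) d (T : measurableType d) (P : probability T R).
Context (n : nat) (r : 'I_n -> R) (law : 'I_n -> probability R R).
Context (v : nat -> 'I_n -> {RV P >-> R}) (H : 'I_n -> set R) (M : nat).
Hypotheses (n_gt0 : (0 < n)%N) (velocities : local_velocities law v).
Hypotheses (M_gt0 : (0 < M)%N) (mH : forall i, measurable (H i)).
Hypotheses (H_gt0 : forall i, (0 < law i (H i))%E).
Hypothesis H_sync : synchronizing r H (n * M * n).

Let K_gt0 : (0 < n * M * n)%N.
Proof. by rewrite !muln_gt0 n_gt0 M_gt0. Qed.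

Let vlaw t i B : measurable B -> P (v t i @^-1` B) = law i B.
Proof. by case: velocities => _ vl _; exact: vl. Qed.

Let vindep : mutually_independent P (velocity_events v).
Proof. by case: velocities. Qed.

Let v_noise (a : nat * 'I_n) (x : T) : R := v a.1 a.2 x.

Let iter_ordS_mod s (i0 : 'I_n) :
  iter (s %% (n * M * n)) (@ordS n) i0 = iter s (@ordS n) i0.
Proof.
apply: ord_inj; rewrite !val_iter_ordS -modnDmr modn_dvdm ?dvdn_mull//.
by rewrite modnDmr.
Qed.

Let round_visits c (i0 i : 'I_n) :
  exists2 s, (c * n <= s < c.+1 * n)%N & iter s (@ordS n) i0 = i.
Proof.
have [k kn ki] := ordS_reach i0 i; exists (k + c * n)%N.
  by rewrite leq_addl mulSn ltn_add2r.
rewrite iterD -[in RHS]ki; congr iter.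
by elim: c => // c IHc; rewrite mulSn iterD IHc iter_ordS_period.
Qed.

(** Common to the rules in which the velocities are the only randomness. *)
Let ergodic_velocities (drive : nat -> ('I_n -> R) -> 'I_n -> R)
    (u : multiplicators n T) :
  (forall s, drive (s %% (n * M * n))%N = drive s) ->
  (forall s i, measurable_fun setT
    (fun y : noise (nat * 'I_n)%type R =>
       drive s (fun j => (y : _ -> R) (s, j)) i)) ->
  (forall xi : nat -> 'I_n -> R, (forall s j, H j (xi s j)) ->
     active_each_round H (fun s => drive s (xi s))) ->
  (forall s i x, (u s i x)%:R * v s i x = drive s (fun j => v s j x) i) ->
  uniquely_ergodic r v u.
Proof.
move=> dper dmeas dact udrive.
have [mu muP] := @driven_process_ergodic _ T R P _ v_noise
  (fun a => measurable_funPT (v a.1 a.2)) vindep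
  (fun s t j B mB => etrans (vlaw s j mB) (esym (vlaw t j mB)))
  (n * M * n) (fun=> H) K_gt0 (fun=> mH) (fun _ _ => erefl)
  (fun s j => eq_ind_r (fun p => (0 < p)%E) (H_gt0 j) (vlaw s j (mH j)))
  n r drive dper dmeas (fun xi xiH => H_sync (dact xi xiH)).
exists mu => D aD f cf bf.
rewrite (_ : (fun t => _) = (fun t =>
  \int[P]_x f (run (fun s => drive s (fun j => v_noise (s, j) x)) D t))).
  exact: muP.
apply/funext => t; apply: eq_Rintegral => x _; rewrite gapsE.
by congr (f (run _ D t)); apply/funext => s; apply/funext => i; exact: udrive.
Qed.

Lemma parallel_ergodic : uniquely_ergodic r v (@parallel n T).
Proof.
apply: (ergodic_velocities (drive := fun _ y => y)) => //.
- by move=> s i; exact: measurable_coordinate.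
- move=> xi xiH; split=> [s i|c i]; first by right.
  exists (c * n)%N; last exact: xiH.
  by rewrite leqnn ltn_pmul2r /=.
- by move=> s i x; rewrite mul1r.
Qed.

Lemma clockwise_ergodic (i0 : 'I_n) : uniquely_ergodic r v (@clockwise n T i0).
Proof.
apply: (ergodic_velocities
  (drive := fun s y i => (i == iter s (@ordS n) i0)%:R * y i)) => //.
- by move=> s; rewrite iter_ordS_mod.
- move=> s i; apply: measurable_funM; first exact: measurable_cst.
  exact: measurable_coordinate.
- move=> xi xiH; split=> [s i|c i].
    by case: eqP; rewrite ?mul0r ?mul1r; [right|left].
  have [s cs si] := round_visits c i0 i; exists s => //.
  by rewrite si eqxx mul1r.
Qed.

Section random_updating.
Variables (q : 'I_n -> R) (kappa : nat -> T -> 'I_n).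
Hypothesis kappa_random : random_index v q kappa.

(* The updated index enters the real-valued noise as the coordinate [None]. *)
Let index_noise (a : nat * option 'I_n) (x : T) : R :=
  if a.2 is Some i then v a.1 i x else (kappa a.1 x : nat)%:R.

Let kappa_preimage t (B : set R) :
  (fun x => (kappa t x : nat)%:R) @^-1` B =
  \bigcup_(i in [set i : 'I_n | B (i : nat)%:R]) kappa t @^-1` [set i].
Proof.
by apply/seteqP; split=> [x Bx|x [i Bi /= ->]//]; exists (kappa t x).
Qed.

Let mkappa t i : measurable (kappa t @^-1` [set i]).
Proof. by case: kappa_random. Qed.

Let measurable_index_noise a : measurable_fun setT (index_noise a).
Proof.
case: a => t [i|]; first exact: measurable_funPT.
move=> _ B mB; rewrite setTI kappa_preimage.
by apply: fin_bigcup_measurable.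
Qed.

Let index_noise_indep : mutually_independent P
  (fun a => preimage_set_system setT (index_noise a) measurable).
Proof.
case: kappa_random => _ _ _; pose h (a : nat * option 'I_n) :=
  if a.2 is Some i then inl (a.1, i) else inr a.1 : (nat * 'I_n) + nat.
pose h' (b : (nat * 'I_n) + nat) : nat * option 'I_n :=
  match b with inl b => (b.1, Some b.2) | inr t => (t, None) end.
apply: (@mutually_independent_reindex _ _ _ _ _ _ _ _ h h').
  by case=> t [i|].
case=> t [i|] //= _ [B mB <-]; exists [set i : 'I_n | B (i : nat)%:R] => //.
Qed.

Let kappa_law t (B : set R) :
  P ((fun x => (kappa t x : nat)%:R) @^-1` B) =
  (\sum_(i \in [set i : 'I_n | B (i : nat)%:R]) (q i)%:E)%E.
Proof.
rewrite kappa_preimage measure_fin_bigcup//.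
- apply: eq_fsbigr => i _; case: kappa_random => _ _ Pk _; exact: Pk.
- exact: finite_finset.
- by move=> i j _ _ [x [/= <- <-]].
Qed.

Let q_gt0 i : 0 < q i.
Proof.
case: kappa_random => -[q0 _ qprod] _ _ _; rewrite lt0r q0 andbT.
by apply/eqP => qi; move: qprod; rewrite (bigD1 i)//= qi mul0r ltxx.
Qed.

(* The updated indices follow the clockwise order with positive probability. *)
Lemma random_ergodic : uniquely_ergodic r v (one_at_a_time kappa).
Proof.
pose i0 := Ordinal n_gt0.
pose drive (s : nat) (y : option 'I_n -> R) (i : 'I_n) : R :=
  (y None == (i : nat)%:R)%:R * y (Some i).
(* Good noise also makes the updated index the clockwise one, an event of probability [q i > 0] for
   that index [i]; on it every particle is updated once per round. *)
pose Hx (s : nat) (j : option 'I_n) : set R :=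
  if j is Some i then H i else [set (iter s (@ordS n) i0 : nat)%:R].
have mHx s j : measurable (Hx s j).
  by case: j => [i|]; [exact: mH|exact: measurable_set1].
have iid s t j B : measurable B ->
    P (index_noise (s, j) @^-1` B) = P (index_noise (t, j) @^-1` B).
  move=> mB; case: j => [i|]; first by rewrite ![LHS]vlaw// ![RHS]vlaw.
  by rewrite [LHS]kappa_law [RHS]kappa_law.
have Hx_gt0 s j : (0 < P (index_noise (s, j) @^-1` Hx s j))%E.
  case: j => [i|]; first by rewrite [X in (_ < X)%E]vlaw.
  have <- : P (kappa s @^-1` [set iter s (@ordS n) i0]) =
      P (index_noise (s, None) @^-1` Hx s None).
    congr (P _); apply/seteqP; split=> x /=; rewrite /index_noise/=.
      by move=> ->.
    by move=> /eqP; rewrite eqr_nat => /eqP /ord_inj.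
  by case: kappa_random => _ _ -> _; rewrite lte_fin.
have [] := @driven_process_ergodic _ T R P _ index_noise
  measurable_index_noise index_noise_indep iid (n * M * n) Hx K_gt0 mHx _ Hx_gt0
  n r drive.
- by move=> s [i|] //=; rewrite iter_ordS_mod.
- by [].
- move=> s i; apply: measurable_funM; last exact: measurable_coordinate.
  apply: (measurableT_comp (f := fun b : bool => b%:R : R)) => //.
  apply: measurable_fun_eqr; first exact: measurable_coordinate.
  exact: measurable_cst.
- move=> xi xiH; apply: H_sync.
  have driveE s i : drive s (xi s) i =
      (i == iter s (@ordS n) i0)%:R * xi s (Some i).
    by rewrite /drive (xiH s None) eqr_nat eq_sym.
  split=> [s i|c i].
    by rewrite driveE; case: eqP; rewrite ?mul0r ?mul1r;
      [right; exact: (xiH s (Some i))|left].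
  have [s cs si] := round_visits c i0 i; exists s => //.
  by rewrite driveE si eqxx mul1r; exact: (xiH s (Some i)).
move=> mu muP; exists mu => D aD f cf bf.
rewrite (_ : (fun t => _) = (fun t =>
  \int[P]_x f (run (fun s => drive s (fun j => index_noise (s, j) x)) D t))).
  exact: muP.
apply/funext => t; apply: eq_Rintegral => x _; rewrite gapsE.
congr (f (run _ D t)); apply/funext => s; apply/funext => i.
by rewrite /drive /index_noise/= /one_at_a_time eqr_nat eq_sym.
Qed.

End random_updating.

End updating_rules.

Theorem theorem2 (R : realType) (d : measure_display) (T : measurableType d)
    (P : probability T R) (n : nat) (n_gt0 : (0 < n)%N)
    (r : 'I_n -> R) (r_ge0 : forall i, 0 <= r i)
    (law : 'I_n -> probability R R) (v : nat -> 'I_n -> {RV P >-> R})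
    (velocities : local_velocities law v)
    (signs : both_signs law)
    (comparison :
      (forall (i j : 'I_n) (t : nat), i != j ->
         (0 < P [set x | (v t i x > v t j x)%R])%E) \/
      (forall (i j : 'I_n) (t : nat), i != j ->
         (0 < P [set x | (v t i x < v t j x)%R])%E)) :
  [/\ (forall (q : 'I_n -> R) (kappa : nat -> T -> 'I_n),
         random_index v q kappa ->
         uniquely_ergodic r v (one_at_a_time kappa)),
      (forall i0 : 'I_n, uniquely_ergodic r v (@clockwise n T i0)) &
      (exists i : 'I_n, forall t : nat,
         (0 < P [set x | (v t i x * v t (ordS i) x < 0)%R])%E) ->
      uniquely_ergodic r v (@parallel n T)].
Proof.
have vlaw t i B : measurable B -> P (v t i @^-1` B) = law i B.
  by case: velocities => _ vl _; exact: vl.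
(* Either form of the comparison, after swapping [i] and [j] if needed, gives [v j < v i] with
   positive probability. This is impossible if almost surely [v i <= 0 <= v j]. *)
have cmp (i j : 'I_n) : i != j -> (0 < law i [set z | (0 < z)%R])%E \/
    (0 < law j [set z | (z < 0)%R])%E.
  move=> ij; have vij : (0 < P [set x | (v 0 j x < v 0 i x)%R])%E.
    by case: comparison => cmp; apply: cmp; rewrite // eq_sym.
  apply: contrapT => /not_orP[/negP + /negP].
  rewrite -!leNgt -(vlaw 0%N i _ (measurable_ray_gt 0)).
  rewrite -(vlaw 0%N j _ (measurable_ray_lt 0)) => Pi Pj.
  move: vij; apply/negP; rewrite -leNgt.
  have mi : measurable (v 0%N i @^-1` [set z | 0 < z]).
    exact: measurable_funPTI (measurable_ray_gt 0).
  have mj : measurable (v 0%N j @^-1` [set z | z < 0]).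
    exact: measurable_funPTI (measurable_ray_lt 0).
  have -> : 0%E = (0 + 0 : \bar R)%E by rewrite adde0.
  apply: le_trans (leeD Pi Pj); apply: le_trans (measureU2 _ mi mj).
  apply: le_measure; rewrite ?inE.
  - rewrite -[X in measurable X]setTI.
    by apply: (@measurable_fun_ltr _ _ _ setT) => //.
  - exact: measurableU.
  - move=> x /= vx; case: (ltP 0 (v 0%N i x)) => vi; [by left|right].
    exact: lt_le_trans vx vi.
have [H [M [M0 mH H0 sync]]] := exists_synchronizing r_ge0 signs cmp.
split=> [q kappa|i0|_].
- exact: (random_ergodic n_gt0 velocities M0 mH H0 sync).
- exact: (clockwise_ergodic n_gt0 velocities M0 mH H0 sync).
- exact: (parallel_ergodic n_gt0 velocities M0 mH H0 sync).
Qed.
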